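(* Let $d\ge 3$. For every finite $K\subset\mathbb{Z}^d$ there exists a constant $c(K)>0$ (depending only on $d$ and $K$) such that for every function $V:\mathbb{Z}^d\to\mathbb{R}$ vanishing outside $K$ with $\sup_x|V(x)|\le c(K)$ and every $u\ge 0$, $$\mathbb{E}\Big[\exp\Big\{-\sum_{x\in\mathbb{Z}^d}V(x)L_{x,u}\Big\}\Big]=\exp\Big\{-u\,\frac{\sum_{I\subseteq K}c_I V_I}{\sum_{I\subseteq K}g_I V_I}\Big\},$$ where $V_I=\prod_{x\in I}V(x)$ (and $V_\emptyset=1$). In addition, this identity holds for every $u\ge 0$ whenever $V$ is nonnegative and vanishes outside $K$ (with no restriction on the size of $V$).
   Context: Green function: $g(x,x')=\sum_{n\ge0}P_x[X_n=x']$ for simple random walk $(X_n)$ on $\mathbb{Z}^d$ started at $x$ under $P_x$. For $I\subset\mathbb{Z}^d$ finite nonempty, $G_I$ is the matrix $(g(x,x'))_{x,x'\in I}$, $g_I=\det G_I$ (which is $>0$), and $c_I$ is the sum of all coefficients of the matrix of cofactors of $G_I$; by convention $g_\emptyset=1$, $c_\emptyset=0$. Continuous time random interlacements on $\mathbb{Z}^d$, $d\ge3$. $\widehat W$ is the space of doubly infinite sequences $(X_n,\sigma_n)_{n\in\mathbb{Z}}$ in $\mathbb{Z}^d\times(0,\infty)$ such that $(X_n)$ is a nearest-neighbour trajectory visiting every finite subset of $\mathbb{Z}^d$ only finitely many times, and $\sum_{n\ge0}\sigma_n=\sum_{n<0}\sigma_n=\infty$; it has the $\sigma$-algebra generated by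 the coordinates. $\widehat W^*=\widehat W/\sim$, where $\widehat w\sim\widehat w'$ iff $\widehat w(\cdot)=\widehat w'(\cdot+k)$ for some $k\in\mathbb{Z}$; $\pi^*:\widehat W\to\widehat W^*$ is the canonical map and $\widehat W^*$ is endowed with the $\sigma$-algebra of sets whose inverse image under $\pi^*$ is measurable. For finite $K\subset\mathbb{Z}^d$ let $e_K(x)=P_x[X_n\notin K\text{ for all }n\ge1]\,1_K(x)$ (equilibrium measure), and let $\widehat Q_K$ be the finite measure on $\widehat W$ with $\widehat Q_K(X_0=x)=e_K(x)$ and such that, when $e_K(x)>0$, conditionally on $X_0=x$, $(X_n)_{n\ge0}$, $(X_{-n})_{n\ge0}$, $(\sigma_n)_{n\in\mathbb{Z}}$ are independent and distributed respectively as simple random walk started at $x$, simple random walk started at $x$ conditioned never to return to $K$ (at times $n\ge 1$), and i.i.d. exponential variables of parameter $1$. There is a unique $\sigma$-finite measure $\widehat\nu$ on $\widehat W^*$ such that for every finite $K$ its restriction to the trajectories modulo time-shift that enter $K$ equals the image of $\widehat Q_K$ under $\pi^*$. Under $\mathbb{P}$ (with expectation $\mathbb{E}$), $\omega=\sum_{i\ge0}\delta_{(\widehat w_i^*,u_i)}$ is a Poisson point process on $\widehat W^*\times\mathbb{R}_+$ with intensity measure $\widehat\nu(d\widehat w^* )\,du$. The occupation times are $$L_{x,u}(\omega)=\sum_{i\ge0}\sum_{n\in\mathbb{Z}}\sigma_n(\widehat w_i)\,1\{X_n(\widehat w_i)=x,\ u_i\le u\},\quad x\in\mathbb{Z}^d,\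 u\ge0,$$ where $\widehat w_i$ is any element with $\pi^*(\widehat w_i)=\widehat w_i^*$. *)

(* Defs.v *)
From HB Require Import structures.
From mathcomp Require Import all_boot all_order all_algebra finmap.
From mathcomp Require Import generic_quotient.
From mathcomp Require Import all_classical all_reals all_analysis.
From mathcomp Require Import measurable_realfun.

Set Implicit Arguments.
Unset Strict Implicit.
Unset Printing Implicit Defensive.
Import Order.TTheory GRing.Theory Num.Theory.
Import numFieldNormedType.Exports.

Local Open Scope classical_set_scope.
Local Open Scope ring_scope.

Definition lattice (d : nat) : Type := 'rV[int]_d.

HB.instance Definition _ d := GRing.Zmodule.on (lattice d).
HB.instance Definition _ d := Countable.on (lattice d).
HB.instance Definition _ d := isPointed.Build (lattice d) 0.
HB.instance Definition _ d := @isMeasurable.Build default_measure_display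
  (lattice d) discrete_measurable discrete_measurable0
  (@discrete_measurableC _) (@discrete_measurableU _).

Definition adjacent d (x y : lattice d) : bool :=
  \sum_(i < d) `|y 0 i - x 0 i| == 1 :> int.

Definition coordinate_events dT (T : measurableType dT) (I : Type)
    : set (set (I -> T)) :=
  [set A | exists i B, measurable B /\ A = [set f | B (f i)]].

Definition walk (d : nat) : Type :=
  g_sigma_algebraType (@coordinate_events _ (lattice d) nat).

HB.instance Definition _ d := Measurable.on (walk d).

Definition weights (R : realType) : Type :=
  g_sigma_algebraType (@coordinate_events _ R int).

HB.instance Definition _ (R : realType) := Measurable.on (weights R).

(* The law of simple random walk, through its finite-dimensional marginals *)
Definition srw_laws (R : realType) d (P : lattice d -> probability (walk d) R) :=
  forall (x : lattice d) (n : nat) (p : nat -> lattice d),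
    P x [set X : walk d | forall k, (k <= n)%N -> X k = p k] =
    ((p 0%N == x)%:R *
     \prod_(k < n) ((adjacent (p k) (p k.+1))%:R / (2 * d)%:R))%:E.

Section green.
Variables (R : realType) (d : nat) (P : lattice d -> probability (walk d) R).
Implicit Types (I K : {fset lattice d}) (x y : lattice d).

Definition green x y : R :=
  fine (\sum_(0 <= n <oo) P x [set X : walk d | X n = y])%E.

Definition green_mx I : 'M[R]_#|` I| :=
  \matrix_(i, j) green I`_i I`_j.

Definition green_det I : R := \det (green_mx I).

Definition green_cof I : R := \sum_i \sum_j cofactor (green_mx I) i j.

Definition no_return K : set (walk d) :=
  [set X | forall n, (1 <= n)%N -> X n \notin K].

Definition equilibrium K x : \bar R :=
  (P x (no_return K) * ((x \in K)%:R)%:E)%E.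

End green.

Section trajectories.
Variables (R : realType) (d : nat).

Definition trajectory (w : int -> lattice d * R) : Prop :=
  [/\ forall n, 0 < (w n).2,
      forall n, adjacent (w n).1 (w (n + 1)).1,
      forall F : {fset lattice d}, finite_set [set n | (w n).1 \in F],
      \esum_(n in [set n : int | 0 <= n]) (w n).2%:E = +oo%E &
      \esum_(n in [set n : int | n < 0]) (w n).2%:E = +oo%E].

Hypothesis d3 : (3 <= d)%N.

Lemma trajectory_ex : exists w, trajectory w.
Proof.
have esumy (A : set int) (f : nat -> int) : injective f ->
    (forall n, A (f n)) -> \esum_(n in A) (1 : R)%:E = +oo%E.
  move=> fI fA; apply/eqyP => r r0; apply: (@esum_ge R _ A (fun=> 1%:E)).
  exists (f @` `I_(Num.bound r)).
    split; first by apply: finite_image; exact: finite_II.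
    by move=> _ [n _ <-].
  rewrite (fsbig_image `I_(Num.bound r) f); last by move=> m n _ _; exact: fI.
  rewrite -fsbig_ord /= sumEFin lee_fin sumr_const card_ord.
  by rewrite (le_trans (ltW (archi_boundP (ltW r0)))).
pose i0 : 'I_d := Ordinal (leq_trans (isT : (0 < 3)%N) d3).
exists (fun n => (\row_i (if i == i0 then n else 0), 1)); split => /=.
- by move=> _; exact: ltr01.
- move=> n; rewrite /adjacent (bigD1 i0)//= !mxE eqxx (addrC n) addrK normr1.
  by rewrite big1 ?addr0// => i /negPf ne; rewrite !mxE ne subrr normr0.
- move=> F; pose c (x : lattice d) : int := x 0 i0.
  apply: (@sub_finite_set _ _ (c @` [set` F])) => [n /= nF|]; last first.
    exact/finite_image/finite_fset.
  by exists (\row_i (if i == i0 then n else 0)) => //; rewrite /c mxE eqxx.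
- by apply: (esumy [set n : int | 0 <= n] Posz) => // m n [].
- by apply: (esumy [set n : int | n < 0] Negz) => // m n [].
Qed.

End trajectories.

(* Measurable types are nonempty in the library, hence the bound on [d]. *)
Definition What (R : realType) (d : nat) (d3 : (3 <= d)%N) : Type :=
  {w : int -> lattice d * R | trajectory w}.

Section What.
Variables (R : realType) (d : nat) (d3 : (3 <= d)%N).
Local Notation W := (What R d3).
Implicit Types (w : W) (K : {fset lattice d}).

HB.instance Definition _ := gen_eqMixin W.
HB.instance Definition _ := gen_choiceMixin W.
HB.instance Definition _ := isPointed.Build W (cid (trajectory_ex R d3)).

Definition What_events : set (set W) :=
  [set A | exists n B, measurable B /\ A = [set w | B (sval w n)]].

HB.instance Definition _ := @isMeasurable.Build (sigma_display What_events) W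
  <<s What_events >> (@sigma_algebra0 _ setT _)
  (@sigma_algebraC _ _) (@sigma_algebra_bigcup _ setT _).

Definition pos w n : lattice d := (sval w n).1.
Definition wgt w n : R := (sval w n).2.
Definition forward w : walk d := fun n => pos w n%:Z.
Definition backward w : walk d := fun n => pos w (- n%:Z).
Definition holding w : weights R := wgt w.
Definition hitting K : set W := [set w | exists n, pos w n \in K].

Definition shift_equiv w w' : bool :=
  `[< exists k : int, forall n, sval w n = sval w' (n + k) >].

Lemma shift_equiv_refl : reflexive shift_equiv.
Proof. by move=> w; apply/asboolP; exists 0 => n; rewrite addr0. Qed.

Lemma shift_equiv_sym : symmetric shift_equiv.
Proof.
move=> w w'; apply: asbool_equiv_eq; split=> -[k h]; exists (- k) => n.
  by rewrite h subrK.
by rewrite h subrK.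
Qed.

Lemma shift_equiv_trans : transitive shift_equiv.
Proof.
move=> w2 w1 w3 /asboolP[k h] /asboolP[l h']; apply/asboolP; exists (k + l) => n.
by rewrite h h' addrA.
Qed.

Canonical shift_equivR :=
  EquivRel shift_equiv shift_equiv_refl shift_equiv_sym shift_equiv_trans.

Definition Wstar : Type := {eq_quot shift_equivR}%qT.

HB.instance Definition _ := Quotient.on Wstar.
HB.instance Definition _ := Choice.on Wstar.
HB.instance Definition _ := isPointed.Build Wstar (\pi_Wstar point)%qT.
Definition pistar (w : W) : Wstar := (\pi_Wstar w)%qT.

Definition Wstar_measurable : set (set Wstar) :=
  [set A | measurable (pistar @^-1` A)].

Lemma Wstar_measurable0 : Wstar_measurable set0.
Proof. by rewrite /Wstar_measurable /= preimage_set0. Qed.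

Lemma Wstar_measurableC A : Wstar_measurable A -> Wstar_measurable (~` A).
Proof. by rewrite /Wstar_measurable /= preimage_setC; exact: measurableC. Qed.

Lemma Wstar_measurable_bigcup (F : (set Wstar)^nat) :
  (forall i, Wstar_measurable (F i)) -> Wstar_measurable (\bigcup_i (F i)).
Proof.
rewrite /Wstar_measurable /= preimage_bigcup => mF.
exact: bigcupT_measurable.
Qed.

HB.instance Definition _ := @isMeasurable.Build default_measure_display Wstar
  Wstar_measurable Wstar_measurable0 Wstar_measurableC Wstar_measurable_bigcup.

End What.

Arguments forward {R d d3}.
Arguments backward {R d d3}.
Arguments holding {R d d3}.
Arguments hitting {R d d3}.
Arguments pistar {R d d3}.

(* Conditional probability of [A] given [E], for a finite measure [mu] *)
Definition cprob (R : realType) dT (T : measurableType dT)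
    (mu : set T -> \bar R) (E A : set T) : R :=
  fine (mu (A `&` E)) / fine (mu E).

Section Qhat_nu.
Variables (R : realType) (d : nat) (d3 : (3 <= d)%N).
Variable P : lattice d -> probability (walk d) R.
Implicit Types (x : lattice d).

(* The five conjuncts: independence of the three components, their first two
   laws, and the weights being independent exponentials of parameter 1 *)
Definition Qhat_conditional_law (K : {fset lattice d}) x
    (Qx : set (What R d3) -> R) : Prop :=
  [/\ forall A B C, measurable A -> measurable B -> measurable C ->
        Qx (forward @^-1` A `&` backward @^-1` B `&` holding @^-1` C) =
        Qx (forward @^-1` A) * Qx (backward @^-1` B) * Qx (holding @^-1` C),
      forall A, measurable A -> Qx (forward @^-1` A) = fine (P x A),
      forall B, measurable B ->
        Qx (backward @^-1` B) = cprob (P x) (no_return K) B,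
      forall (s : seq int) (C : int -> set R), uniq s ->
        (forall n, measurable (C n)) ->
        Qx [set w | forall n, n \in s -> C n (wgt w n)] =
        \prod_(n <- s) Qx [set w | C n (wgt w n)] &
      forall n (C : set R), measurable C ->
        Qx [set w | C (wgt w n)] = fine (exponential_prob 1 C)].

Definition is_Qhat (K : {fset lattice d})
    (Q : {finite_measure set (What R d3) -> \bar R}) : Prop :=
  (forall x, Q [set w | pos w 0 = x] = equilibrium P K x) /\
  (forall x, (0 < equilibrium P K x)%E ->
    Qhat_conditional_law K x (cprob Q [set w | pos w 0 = x])).

Definition is_nuhat
    (Q : {fset lattice d} -> {finite_measure set (What R d3) -> \bar R})
    (nu : {sigma_finite_measure set (Wstar R d3) -> \bar R}) : Prop :=
  forall (K : {fset lattice d}) (A : set (Wstar R d3)), measurable A ->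
    nu (A `&` pistar @` hitting K) = Q K (pistar @^-1` A).

End Qhat_nu.

Section point_process.
Variables (R : realType) (dO dT : measure_display).
Variables (Omega : measurableType dO) (T : measurableType dT).
Variable pts : Omega -> nat -> T.

(* The value at [A] of the random point measure [\sum_i \d_(pts o i)] *)
Definition point_count (A : set T) (o : Omega) : \bar R :=
  (\sum_(0 <= i <oo) \d_(pts o i) A)%E.

(* Only the counting variables are required to be measurable: the labelling
   [i] of the points is arbitrary. The second argument of [poisson_prob] is a
   dummy one. *)
Definition poisson_process (Pr : probability Omega R) (mu : set T -> \bar R) :=
  [/\ forall A, measurable A -> measurable_fun setT (point_count A),
      forall A k, measurable A -> (mu A < +oo)%E ->
        Pr [set o | point_count A o = k%:R%:E] =
        poisson_prob (fine (mu A)) 0 [set k],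
      forall A, measurable A -> mu A = +oo%E ->
        Pr [set o | point_count A o = +oo%E] = 1%E &
      forall n (A : 'I_n -> set T) (B : 'I_n -> set (\bar R)),
        (forall j, measurable (A j)) -> trivIset setT A ->
        (forall j, measurable (B j)) ->
        Pr [set o | forall j, B j (point_count (A j) o)] =
        (\prod_(j < n) Pr [set o | B j (point_count (A j) o)])%E].

End point_process.

Section interlacements.
Variables (R : realType) (d : nat) (d3 : (3 <= d)%N).
Variables (dO : measure_display) (Omega : measurableType dO).
Variable pts : Omega -> nat -> Wstar R d3 * R.

(* [nu(dw) du] on [Wstar * R_+], as a measure on [Wstar * R] *)
Definition intensity (nu : {sigma_finite_measure set (Wstar R d3) -> \bar R})
    (A : set (Wstar R d3 * R)) : \bar R :=
  (nu \x lebesgue_measure)%E (A `&` [set p | 0 <= p.2]).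

Definition random_interlacements (P : lattice d -> probability (walk d) R)
    (Q : {fset lattice d} -> {finite_measure set (What R d3) -> \bar R})
    (nu : {sigma_finite_measure set (Wstar R d3) -> \bar R})
    (Pr : probability Omega R) : Prop :=
  [/\ srw_laws P, forall K, is_Qhat P K (Q K), is_nuhat Q nu,
      forall o i, 0 <= (pts o i).2 & poisson_process pts Pr (intensity nu)].

Definition occupation_time (x : lattice d) (u : R) (o : Omega) : \bar R :=
  (\sum_(0 <= i <oo) \esum_(n in [set: int])
    (let w := repr (pts o i).1 in
     (wgt w n * ((pos w n == x) && ((pts o i).2 <= u)%R)%:R)%R%:E))%E.

(* The Laplace transform identity, including that its right-hand side is
   meaningful: [_ / 0] is [0] in the library. *)
Definition laplace_identity (P : lattice d -> probability (walk d) R)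
    (Pr : probability Omega R) (K : {fset lattice d}) (V : lattice d -> R)
    (u : R) : Prop :=
  let num := \sum_(I <- fpowerset K) green_cof P I * \prod_(x <- I) V x in
  let den := \sum_(I <- fpowerset K) green_det P I * \prod_(x <- I) V x in
  den != 0 /\
  (\int[Pr]_o expeR (- \sum_(x \in [set: lattice d])
                          (V x)%:E * occupation_time x u o) =
   (expR (- (u * (num / den))))%:E)%E.

End interlacements.

(* Main.v *)
Require Import Defs.
From HB Require Import structures.
From mathcomp Require Import perm generic_quotient.
From mathcomp Require Import all_boot all_order all_algebra finmap.
From mathcomp Require Import all_classical all_reals all_analysis.
From mathcomp Require Import measurable_realfun ring lra zify.

(** The walk expectations [fk a n] of products along a path satisfy the Duhamel
formula [1 - fk a n x = \sum_k P^k ((1 - a) P (fk a (n - k - 1)))]. With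
[a = 1 / (1 + V)], the Laplace transform of a mean one exponential holding time
with rate [V], the limit [phi] solves [phi + G V phi = 1] on [K]; with [a] the
indicator of the complement of [K] one gets [G e_K = 1] on [K]. Hence the
Laplace functional of one trajectory under [Qhat_K] integrates to
[- \sum_(y in K) V y * phi y] once the total mass is subtracted, and Cramer's
rule with [det (1 + V G) = \sum_I g_I V_I] and [det (G_I + J) = g_I + c_I] for
the all-ones matrix [J] rewrites this as the stated quotient. The Poisson process
enters through [E (\prod_i h (w_i)) = exp (u * \int (h - 1) dnu)], where [h >= 0]
is approximated from below by simple functions, so that both signs of [V] are
treated at once. Transience of the walk comes for free: otherwise every
equilibrium measure would vanish, hence the intensity too, contradicting that the
process has infinitely many points. *)

Set Implicit Arguments.
Unset Strict Implicit.
Unset Printing Implicit Defensive.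
Import Order.TTheory GRing.Theory Num.Theory.
Import numFieldNormedType.Exports.
Local Open Scope classical_set_scope.
Local Open Scope ring_scope.

(* [adjacent] is also a name of the [sequences] library. *)
Local Notation adjacent := Defs.adjacent.

(** * Principal minors and rank one updates *)

(** The constant has to be fixed before any process is given, while transience is only known once a
    process exists. So the heat kernel, the Green function and the functionals [fk] are built as
    plain real numbers from the averaging operator, and are matched with the laws [P x] afterwards.
    Signed potentials are controlled by a function [U] with [0 <= U < 1] and [- U <= V]: the
    functional for [- U] is monotone and bounded, and it yields the integrable majorant under
    [Qhat_K]. The choice is [U = 0] for [V >= 0] and [U = |V|] for small [V]. That the denominator
    does not vanish is the injectivity of [1 + G V] on [K], with one proof per case: a
    subharmonicity argument for [V >= 0], a contraction for small [V]. On the probability space only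
    the counts are known to be measurable, so functionals of the points are reached through products
    of powers of counts, on the almost sure event that finitely many points matter. *)

Section rank_one_update.
Variables (R : comNzRingType) (n : nat).
Implicit Types (A : 'M[R]_n) (u : 'cV[R]_n) (v : 'rV[R]_n).

(** Expansion along the first row, then along the first column of each minor: what remains are the
    cofactors of [A]. The zero corner removes the term [\det A]. *)
Lemma det_bordered A u v :
  \det (block_mx (0 : 'M[R]_1) v u A) = - (v *m \adj A *m u) 0 0.
Proof.
rewrite (expand_det_row _ (lshift n 0)) (@big_split_ord _ _ _ 1 n) /= big_ord1.
rewrite block_mxEul mxE mul0r add0r -mulmxA mxE -sumrN.
apply: eq_bigr => k _; rewrite block_mxEur -mulrN; congr (_ * _).
rewrite /cofactor mxE -sumrN.
case: n A u v k => [|m] A u v k; first by case: k.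
rewrite (expand_det_col _ 0) mulr_sumr; apply: eq_bigr => i _.
rewrite [\adj _ _ _]mxE /cofactor.
have -> : row' (lshift m.+1 0) (col' (rshift 1 k) (block_mx (0 : 'M[R]_1) v u A)) i 0 = u i 0.
  do 2 rewrite mxE.
  have -> : @lift (1 + m.+1) (lshift m.+1 0) i = rshift 1 i by apply: val_inj.
  have -> : @lift (1 + m.+1) (rshift 1 k) 0 = lshift m.+1 0.
    by apply: val_inj.
  exact: (block_mxEdl (0 : 'M[R]_1) v u A i 0).
have -> : row' i (col' 0 (row' (lshift m.+1 0) (col' (rshift 1 k)
   (block_mx (0 : 'M[R]_1) v u A)))) = row' i (col' k A).
  apply/matrixP => a b; do 4 rewrite mxE.
  rewrite [RHS]mxE [in RHS]mxE.
  have -> : @lift (1 + m.+1) (lshift m.+1 0) (lift i a) = rshift 1 (lift i a) by apply: val_inj.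
  have -> : @lift (1 + m.+1) (rshift 1 k) (lift 0 b) = rshift 1 (lift k b).
    by apply: val_inj; rewrite /= /bump /= !add1n ltnS addnS.
  exact: (block_mxEdr (0 : 'M[R]_1) v u A).
rewrite /= !addn0 !add0n !add1n exprS exprD; ring.
Qed.

(** Both sides compute the determinant of the block matrix with rows [(1, - v)] and [(u, A)]:
    eliminating [u] leaves the block [A + u *m v], while splitting the first row as
    [(1, 0) + (0, - v)] gives [\det A] plus a bordered determinant. With the adjugate in place of an
    inverse, singular [A] is included. *)
Lemma det_rank_one_update A u v :
  \det (A + u *m v) = \det A + (v *m \adj A *m u) 0 0.
Proof.
have E : block_mx 1%:M (- v) u A =
    block_mx (1%:M : 'M[R]_1) 0 u 1%:M *m block_mx 1%:M (- v) 0 (A + u *m v).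
  by rewrite mulmx_block !mul1mx !mul0mx !mulmx1 ?mulmx0 !addr0 mulmxN addrC addrK.
have := congr1 determinant E.
rewrite det_mulmx det_lblock det_ublock !det1 !mul1r => <-.
rewrite (@determinant_multilinear _ _ _ (block_mx 1%:M 0 u A)
  (block_mx (0 : 'M[R]_1) (- v) u A) (lshift n 0) 1 1).
- by rewrite !mul1r det_lblock det1 mul1r det_bordered !mulNmx mxE opprK.
- have rowE (B : 'M[R]_(1 + n)) i j : row i B 0 j = B i j by rewrite mxE.
  rewrite !scale1r; apply/rowP => j; rewrite [RHS]mxE !rowE.
  case: (split_ordP j) => j' ->; first by rewrite !block_mxEul [X in _ + X]mxE addr0.
  by rewrite !block_mxEur [X in X + _]mxE add0r.
- apply/matrixP => i j; rewrite [LHS]mxE [RHS]mxE; set k := lift _ _.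
  have -> : k = rshift 1 i by apply: val_inj.
  by case: (split_ordP j) => j' ->; rewrite ?block_mxEdl ?block_mxEdr.
- apply/matrixP => i j; rewrite [LHS]mxE [RHS]mxE; set k := lift _ _.
  have -> : k = rshift 1 i by apply: val_inj.
  by case: (split_ordP j) => j' ->; rewrite ?block_mxEdl ?block_mxEdr.
Qed.
End rank_one_update.

Section principal_minors.
Variables (R : comNzRingType) (T : choiceType) (x0 : T).
Implicit Types (k g : T -> T -> R) (s t : seq T) (V : T -> R).

Definition kernel_mx k s : 'M[R]_(size s) :=
  \matrix_(i, j) k (nth x0 s i) (nth x0 s j).

Definition kernel_det k s : R := \det (kernel_mx k s).

Definition kernel_cof k s : R := \sum_i \sum_j cofactor (kernel_mx k s) i j.

Lemma kernel_det_tuple n k (u : n.-tuple T) :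
  kernel_det k u = \det (\matrix_(i, j) k (tnth u i) (tnth u j)).
Proof.
case: u => s sn /=; have e := eqP sn; case: n / e sn => sn.
by congr (\det _); apply/matrixP => i j; rewrite !mxE !(tnth_nth x0).
Qed.

Lemma perm_kernel_det k s t : perm_eq s t -> kernel_det k s = kernel_det k t.
Proof.
move=> st; have /tuple_permP[p ->] : perm_eq s (in_tuple t) by [].
rewrite kernel_det_tuple [RHS](kernel_det_tuple k (in_tuple t)).
set A := (X in _ = \det X).
have -> : (\matrix_(i, j) k (tnth [tuple tnth (in_tuple t) (p i) | i < size t] i)
    (tnth [tuple tnth (in_tuple t) (p i) | i < size t] j)) = row_perm p (col_perm p A).
  by apply/matrixP => i j; rewrite !mxE !tnth_mktuple.
rewrite row_permE col_permE !det_mulmx !det_perm odd_permV mulrCA -signr_addb.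
by rewrite addbb mulr1.
Qed.

(** Multilinearity in the row of [x], which is a unit vector plus [v] times the row of [k2]; since
    [x] is not in [s], the unit vector has its 1 in the corner only and makes the matrix block
    triangular. *)
Lemma kernel_det_cons k1 k2 v x s :
    x \notin s ->
    {in x :: s, forall z, k1 x z = (x == z)%:R + v * k2 x z} ->
    {in s & x :: s, forall y z, k1 y z = k2 y z} ->
  kernel_det k1 (x :: s) = kernel_det k2 s + v * kernel_det k2 (x :: s).
Proof.
move=> xs h1 h2; pose u : 'cV[R]_(size s) := \col_i k2 (nth x0 s i) x.
rewrite /kernel_det.
rewrite (@determinant_multilinear _ _ _ (block_mx (1%:M : 'M[R]_1) 0 u (kernel_mx k2 s))
  (kernel_mx k2 (x :: s)) (lshift (size s) 0) 1 v).
- by rewrite det_lblock det1 mul1r mul1r.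
- apply/rowP => j; rewrite [LHS]mxE [RHS]mxE.
  rewrite [X in _ = X + _]mxE [X in _ = _ * X + _]mxE.
  rewrite [X in _ = _ + X]mxE [X in _ = _ + _ * X]mxE mul1r [LHS]mxE.
  rewrite [X in _ = _ + _ * X]mxE h1 ?mem_nth//.
  congr (_ + _); case: (split_ordP j) => j' ->; rewrite ?block_mxEul ?block_mxEur /= mxE.
    by rewrite (ord1 j') /= eqxx.
  by rewrite add0n /=; case: eqP => // e; rewrite e mem_nth in xs.
- apply/matrixP => i j; rewrite [LHS]mxE [RHS]mxE; set e := lift _ _.
  have -> : e = rshift 1 i by apply: val_inj.
  rewrite [RHS]mxE h2 ?mem_nth//; last exact: (mem_nth x0 (ltn_ord i)).
  by case: (split_ordP j) => j' ->; rewrite ?block_mxEdl ?block_mxEdr mxE //= (ord1 j').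
- apply/matrixP => i j; rewrite [LHS]mxE [RHS]mxE; set e := lift _ _.
  have -> : e = rshift 1 i by apply: val_inj.
  rewrite [LHS]mxE [RHS]mxE h2 ?mem_nth//; exact: (mem_nth x0 (ltn_ord i)).
Qed.

(* The rows in [s] are those of [1 + V g], the other ones those of [g]: unmarking
   the rows one at a time by multilinearity produces the principal minors. *)
Definition row_marked V g s x y : R :=
  if x \in s then (x == y)%:R + V x * g x y else g x y.

Fixpoint minor_sum V g s t : R :=
  if s is x :: s' then minor_sum V g s' t + V x * minor_sum V g s' (x :: t)
  else kernel_det g t.

Lemma kernel_det_marked V g s t :
  uniq (s ++ t) -> kernel_det (row_marked V g s) (s ++ t) = minor_sum V g s t.
Proof.
elim: s t => [|x s ih] t //= /andP[xst ust].
rewrite (@kernel_det_cons _ (row_marked V g s) (V x))//.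
(* In the second term [x] must be moved from the front past [s] into the unmarked part; a principal
   minor ignores the order of its indices. *)
- rewrite ih//; congr (_ + _ * _); rewrite -ih.
    by apply: perm_kernel_det; rewrite -cat1s perm_catCA.
  by rewrite -cat1s uniq_catCA /= xst.
- move=> z _; rewrite /row_marked mem_head; case: ifPn => // xs.
  by rewrite mem_cat xs in xst.
- move=> y z yst _; rewrite /row_marked inE; case: eqP => //= e.
  by move: xst; rewrite -e yst.
Qed.

Lemma fpowersetU1 (x : T) (A : {fset T}) : x \notin A ->
  perm_eq (fpowerset (x |` A)%fset)
          (fpowerset A ++ map (fun I => x |` I)%fset (fpowerset A)).
Proof.
move=> xA; have sub I : I \in fpowerset A -> x \notin I.
  by rewrite fpowersetE => /fsubsetP IA; apply: contra xA; exact: IA.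
apply: uniq_perm; first exact: fset_uniq.
  rewrite cat_uniq fset_uniq /=; apply/andP; split.
    apply/hasPn => _ /mapP[I IA ->]; apply/negP => /sub.
    by rewrite fset1U1.
  rewrite map_inj_in_uniq ?fset_uniq// => I J IA JA e.
  by rewrite -(fsetU1K (sub _ IA)) e (fsetU1K (sub _ JA)).
move=> I; rewrite fpowersetE mem_cat fpowersetE; apply/idP/orP.
  move=> /fsubsetP IA; case: (boolP (x \in I)) => xI; [right|left].
    apply/mapP; exists (I `\ x)%fset; last by rewrite fsetD1K.
    rewrite fpowersetE; apply/fsubsetP => y; rewrite in_fsetD1 => /andP[yx /IA].
    by rewrite in_fset1U (negPf yx).
  apply/fsubsetP => y yI; have := IA _ yI; rewrite in_fset1U => /orP[/eqP e|//].
  by rewrite -e yI in xI.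
case=> [IA|/mapP[J]]; first by rewrite (fsubset_trans IA)// fsubsetUr.
by rewrite fpowersetE => JA ->; rewrite fsetUS.
Qed.

Lemma sum_fpowerset_minors V g (A : {fset T}) s t :
    perm_eq A s -> uniq (s ++ t) ->
  \sum_(I <- fpowerset A) kernel_det g (I ++ t) * \prod_(x <- I) V x =
  minor_sum V g s t.
Proof.
elim: s A t => [|x s ih] A t As.
  have -> : A = fset0 by apply/fsetP => y; rewrite (perm_mem As).
  by move=> _; rewrite fpowerset0 big_seq_fset1 /= big_nil mulr1.
rewrite [uniq _]/= => /andP[xst ust].
have xA : x \in A by rewrite (perm_mem As) mem_head.
have As' : perm_eq (A `\ x)%fset s.
  rewrite -(perm_cons x); apply: perm_trans As.
  apply: uniq_perm; rewrite /= ?in_fsetD1 ?eqxx ?fset_uniq// => y.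
  rewrite inE in_fsetD1; case: eqP => [->|//]; by rewrite xA.
rewrite -{1}(fsetD1K xA) (perm_big _ (fpowersetU1 _)) ?in_fsetD1 ?eqxx//=.
rewrite big_cat big_map /= (ih _ _ As')//; congr (_ + _).
rewrite -(ih _ _ As'); last by rewrite -cat1s uniq_catCA /= xst.
rewrite mulr_sumr !big_seq; apply: eq_bigr => I; rewrite fpowersetE => /fsubsetP IA.
have xI : x \notin I by apply/negP => /IA; rewrite in_fsetD1 eqxx.
have pI : perm_eq (x |` I)%fset (x :: I).
  apply: uniq_perm; rewrite /= ?xI ?fset_uniq// => y.
  by rewrite in_fset1U inE.
rewrite (perm_big _ pI) /= big_cons mulrCA; congr (_ * (_ * _)).
apply: perm_kernel_det; rewrite -cat1s perm_sym perm_catCA perm_sym.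
by rewrite catA perm_cat2r.
Qed.

Definition marked_mx V g s : 'M[R]_(size s) :=
  \matrix_(i, j) ((i == j)%:R + V (nth x0 s i) * g (nth x0 s i) (nth x0 s j)).

Lemma det_marked_mx V g (A : {fset T}) : \det (marked_mx V g A) =
  \sum_(I <- fpowerset A) kernel_det g I * \prod_(x <- I) V x.
Proof.
transitivity (kernel_det (row_marked V g A) A).
  congr (\det _); apply/matrixP => i j; rewrite !mxE /row_marked mem_nth//.
  by rewrite nth_uniq ?fset_uniq.
under eq_bigr do rewrite -[X in kernel_det g X]cats0.
rewrite (@sum_fpowerset_minors _ _ _ A [::]) ?cats0 ?fset_uniq//.
by rewrite -kernel_det_marked ?cats0 ?fset_uniq.
Qed.

(** The sum of all cofactors is [1^T adj(G) 1], which is the increment of the determinant under the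
    rank one matrix with all entries 1. *)
Lemma kernel_detD1 g s :
  kernel_det (fun x y => g x y + 1) s = kernel_det g s + kernel_cof g s.
Proof.
have -> : kernel_det (fun x y => g x y + 1) s =
    \det (kernel_mx g s + (const_mx 1 : 'cV[R]_(size s)) *m (const_mx 1 : 'rV[R]_(size s))).
  by congr (\det _); apply/matrixP => i j; rewrite !mxE big_ord1 !mxE mulr1.
rewrite det_rank_one_update; congr (_ + _).
rewrite mxE; apply: eq_bigr => i _; rewrite !mxE mulr1.
by apply: eq_bigr => j _; rewrite !mxE mul1r.
Qed.

(** By symmetry of [g], the row [w] of values of [f] satisfies [w M = 1^T] with [M = 1 + V g]. Hence
    the rank one term of [\det (M + v 1^T)] is [1^T adj(M) v = w M adj(M) v = \det M * (w v)]. On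
    the other hand [M + v 1^T] is [1 + V (g + 1)], whose expansion has the coefficients [g_I + c_I].
    Nothing is divided by [\det M]. *)
Lemma cof_sum_solution V g (A : {fset T}) (f : T -> R) :
    (forall x y, g x y = g y x) ->
    {in A, forall x, f x + \sum_(y <- A) g x y * (V y * f y) = 1} ->
  \sum_(I <- fpowerset A) kernel_cof g I * \prod_(x <- I) V x =
  (\sum_(I <- fpowerset A) kernel_det g I * \prod_(x <- I) V x) *
  \sum_(y <- A) V y * f y.
Proof.
move=> gC fE; pose v : 'cV[R]_(size A) := \col_i V (nth x0 A i).
pose w : 'rV[R]_(size A) := \row_i f (nth x0 A i).
have wM : w *m marked_mx V g A = const_mx 1.
  apply/rowP => j; rewrite !mxE -[RHS](fE (nth x0 A j)) ?mem_nth//.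
  under eq_bigr do rewrite !mxE mulrDr.
  rewrite big_split /= (bigD1 j)//= eqxx mulr1 big1 ?addr0; last first.
    by move=> i ij; rewrite (negPf ij) mulr0.
  congr (_ + _); rewrite (big_nth x0) big_mkord; apply: eq_bigr => i _.
  by rewrite (gC (nth x0 A j)); ring.
have detD : \det (marked_mx V g A + v *m const_mx 1) =
    \det (marked_mx V g A) * (1 + \sum_(y <- A) V y * f y).
  rewrite det_rank_one_update -wM -[w *m _ *m _]mulmxA mul_mx_adj mul_mx_scalar -scalemxAl.
  rewrite mulrDr mulr1; congr (_ + _); rewrite !mxE; congr (_ * _).
  rewrite (big_nth x0) big_mkord; apply: eq_bigr => i _; rewrite !mxE mulrC//.
rewrite -det_marked_mx; apply: (addrI (\det (marked_mx V g A))).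
rewrite -[X in _ = X + _]mulr1 -mulrDr -detD.
have -> : marked_mx V g A + v *m const_mx 1 = marked_mx V (fun x y => g x y + 1) A.
  by apply/matrixP => i j; rewrite !mxE big_ord1 !mxE; ring.
rewrite !det_marked_mx -big_split /=; apply: eq_bigr => I _.
by rewrite -mulrDl -kernel_detD1.
Qed.

End principal_minors.

(** A zero determinant would give a left null vector of [1 + V g]; by symmetry of [g] its entries,
    read as a function on [A], solve the homogeneous equation. *)
Lemma det_marked_mx_neq0 (F : fieldType) (T : choiceType) (x0 : T)
    (V : T -> F) (g : T -> T -> F) (A : {fset T}) :
    (forall x y, g x y = g y x) ->
    (forall f : T -> F,
      {in A, forall x, f x + \sum_(y <- A) g x y * (V y * f y) = 0} ->
      {in A, forall x, f x = 0}) ->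
  \sum_(I <- fpowerset A) kernel_det x0 g I * \prod_(x <- I) V x != 0.
Proof.
move=> gC ker0; rewrite -det_marked_mx; apply/negP => /det0P[w w0 wM].
pose f x := if insub (index x A) is Some i then w 0 i else 0.
have fE (i : 'I_(size A)) : f (nth x0 A i) = w 0 i.
  by rewrite /f index_uniq ?fset_uniq// valK.
have f0 : {in A, forall x, f x = 0}.
  apply: ker0 => x xA; have ix : (index x A < size A)%N by rewrite index_mem.
  have [j <-] : exists j : 'I_(size A), nth x0 A j = x.
    by exists (Ordinal ix); rewrite /= nth_index.
  move/rowP/(_ j): wM; rewrite !mxE => wM; rewrite -[RHS]wM.
  under [RHS]eq_bigr do rewrite !mxE mulrDr.
  rewrite big_split /= [X in _ = X + _](bigD1 j)//= eqxx mulr1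
    [X in _ = _ + X + _]big1 ?addr0; last first.
    by move=> i ij; rewrite (negPf ij) mulr0.
  rewrite -fE; congr (_ + _).
  rewrite (big_nth x0) big_mkord; apply: eq_bigr => i _.
  by rewrite fE (gC (nth x0 A j)); ring.
by case/eqP: w0; apply/rowP => i; rewrite mxE -fE f0 ?mem_nth.
Qed.

(** * Simple random walk averages *)

Section steps.
Variable d : nat.
Implicit Types x y : lattice d.

Definition unit_step (i : 'I_d) : lattice d := delta_mx 0 i.

Definition steps : seq (lattice d) :=
  [seq unit_step i | i <- enum 'I_d] ++ [seq - unit_step i | i <- enum 'I_d].

Lemma size_steps : size steps = (2 * d)%N.
Proof.
have -> : (2 * d)%N = (size (enum (ordinal d)) + size (enum (ordinal d)))%N.
  by rewrite size_enum_ord mul2n addnn.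
by rewrite size_cat !size_map.
Qed.

Lemma unit_step_inj : injective unit_step.
Proof.
move=> i j /rowP/(_ i); rewrite !mxE !eqxx /=.
by case: eqP => //= ij /eqP; rewrite oner_eq0.
Qed.

Lemma uniq_steps : uniq steps.
Proof.
have negI : injective (fun i => - unit_step i) by move=> i j /oppr_inj/unit_step_inj.
rewrite cat_uniq (map_inj_uniq unit_step_inj) (map_inj_uniq negI) enum_uniq andbT.
apply/hasPn => _ /mapP[i _ ->]; apply/negP => /mapP[j _ /rowP/(_ i)].
by rewrite !mxE !eqxx /=; case: eqP.
Qed.

Lemma perm_opp_steps : perm_eq (map -%R steps) steps.
Proof.
rewrite /steps map_cat perm_catC; set u := map unit_step _.
have -> : [seq - unit_step i | i <- enum 'I_d] = map -%R u.
  by apply: (@map_comp _ _ _ -%R unit_step).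
by rewrite (mapK (@opprK _)).
Qed.

Lemma adjacentE x y : adjacent x y = (y - x \in steps).
Proof.
pose z : 'rV[int]_d := y - x; rewrite /adjacent -/z.
have -> : \sum_(i < d) `|(y : 'rV[int]_d) 0 i - (x : 'rV[int]_d) 0 i| = \sum_(i < d) `|z 0 i|.
  by apply: eq_bigr => i _; rewrite !mxE.
clearbody z; apply/eqP/idP; last first.
  rewrite mem_cat => /orP[] /mapP[i _ ->]; rewrite (bigD1 i)//= big1.
  - by rewrite !mxE !eqxx.
  - by move=> j /negPf ji; rewrite !mxE /= ji.
  - by rewrite !mxE !eqxx.
  - by move=> j /negPf ji; rewrite !mxE /= ji.
move=> z1; have [i zi] : exists i, z 0 i != 0.
  apply/existsP/negP => /pred0P h; suff : \sum_(i < d) `|z 0 i| = 0 by rewrite z1.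
  by rewrite big1// => i _; have /negbFE/eqP -> := h i.
have {}z1 : \sum_(j < d) `|z 0 j| = 1%R := z1.
move: z1; rewrite (bigD1 i)//= => z1.
have zi1 : 1 <= `|z 0 i| by rewrite -gtz0_ge1 normr_gt0.
have s0 : 0 <= \sum_(j < d | j != i) `|z 0 j| by apply: sumr_ge0.
have {}zi1 : `|z 0 i| = 1 by apply/eqP; rewrite eq_le zi1 andbT -z1 lerDl.
have {s0 z1} /eqP : \sum_(j < d | j != i) `|z 0 j| = 0.
  by apply: (addrI `|z 0 i|); rewrite addr0 z1.
rewrite psumr_eq0// => /allP h.
have zj j : j != i -> z 0 j = 0.
  by move=> ji; have := h j; rewrite mem_index_enum ji normr_eq0 => /(_ isT)/eqP.
rewrite mem_cat; have /orP[/eqP e|/eqP e] : (z 0 i == 1) || (z 0 i == -1).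
  by move: zi1; case: ger0P => _ <-; rewrite ?opprK eqxx ?orbT.
  apply/orP; left; apply/mapP; exists i; rewrite ?mem_enum//.
  by apply/rowP => j; rewrite !mxE /=; case: eqP => [->//|/eqP/zj].
apply/orP; right; apply/mapP; exists i; rewrite ?mem_enum//.
by apply/rowP => j; rewrite !mxE /=; case: eqP => [->//|/eqP/zj ->]; rewrite oppr0.
Qed.

End steps.

Lemma cvg_sum_seq (R : realType) (I : eqType) (r : seq I) (F : nat -> I -> R)
    (l : I -> R) : {in r, forall i, F n i @[n --> \oo] --> l i} ->
  \sum_(i <- r) F n i @[n --> \oo] --> \sum_(i <- r) l i.
Proof.
elim: r => [|i r ih] Fl; first by rewrite big_nil; under eq_fun do rewrite big_nil; exact: cvg_cst.
rewrite big_cons; under eq_fun do rewrite big_cons.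
apply: cvgD; first by apply: Fl; rewrite mem_head.
by apply: ih => j jr; apply: Fl; rewrite inE jr orbT.
Qed.

Section averaging.
Variables (R : realType) (d : nat).
Hypothesis d_gt0 : (0 < d)%N.
Implicit Types (x y z : lattice d) (f g a : lattice d -> R).

Definition avg f x : R := (\sum_(s <- steps d) f (x + s)) / (2 * d)%:R.

Let d2 : (2 * d)%:R != 0 :> R.
Proof. by rewrite pnatr_eq0 muln_eq0 /= -lt0n. Qed.

Lemma avg_cst (c : R) x : avg (fun=> c) x = c.
Proof.
by rewrite /avg big_const_seq count_predT size_steps iter_addr_0 -[c *+ _]mulr_natr mulfK.
Qed.

Lemma avgD f g x : avg (fun z => f z + g z) x = avg f x + avg g x.
Proof. by rewrite /avg big_split mulrDl. Qed.

Lemma avgZ (c : R) f x : avg (fun z => c * f z) x = c * avg f x.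
Proof. by rewrite /avg -mulr_sumr mulrA. Qed.

Lemma avgB f g x : avg (fun z => f z - g z) x = avg f x - avg g x.
Proof.
rewrite avgD -[X in _ = _ + X]mulN1r -avgZ; congr (_ + avg _ _).
by apply/funext => z; rewrite mulN1r.
Qed.

Lemma avg_sum I (r : seq I) (F : I -> lattice d -> R) x :
  avg (fun z => \sum_(i <- r) F i z) x = \sum_(i <- r) avg (F i) x.
Proof. by rewrite /avg exchange_big mulr_suml. Qed.

Lemma le_avg f g x : (forall z, f z <= g z) -> avg f x <= avg g x.
Proof. by move=> fg; rewrite ler_wpM2r ?invr_ge0// ler_sum. Qed.

Lemma avg_ge0 f x : (forall z, 0 <= f z) -> 0 <= avg f x.
Proof. by move=> f0; rewrite -(avg_cst 0 x) le_avg. Qed.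

Lemma ler_norm_avg f x : `|avg f x| <= avg (fun z => `|f z|) x.
Proof.
rewrite /avg normrM normfV [X in _ / X]ger0_norm//.
by rewrite ler_wpM2r ?invr_ge0// ler_norm_sum.
Qed.

Lemma avg_translate f y x : avg (fun z => f (z + y)) x = avg f (x + y).
Proof. by congr (_ / _); apply: eq_bigr => s _; rewrite addrAC. Qed.

Lemma avg_opp f x : avg (fun z => f (- z)) x = avg f (- x).
Proof.
congr (_ / _); rewrite -(perm_big _ (perm_opp_steps d)) big_map.
by apply: eq_bigr => s _; rewrite opprB addrC.
Qed.

Lemma cvg_avg (F : nat -> lattice d -> R) f x :
  (forall z, F n z @[n --> \oo] --> f z) -> avg (F n) x @[n --> \oo] --> avg f x.
Proof.
move=> Ff; apply: cvgM; last exact: cvg_cst.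
by apply: cvg_sum_seq => s _; exact: Ff.
Qed.

Lemma iter_avgS n f x : iter n avg (avg f) x = iter n.+1 avg f x.
Proof. by rewrite iterSr. Qed.

Lemma le_iter_avg n f g x : (forall z, f z <= g z) -> iter n avg f x <= iter n avg g x.
Proof. by elim: n x => [|n ih] x fg //=; apply: le_avg => z; exact: ih. Qed.

Lemma iter_avgZ n c f x : iter n avg (fun z => c * f z) x = c * iter n avg f x.
Proof.
elim: n x => [|n ih] x //=; rewrite -avgZ; congr avg; apply/funext => z; exact: ih.
Qed.

Lemma iter_avg_sum n I (r : seq I) (F : I -> lattice d -> R) x :
  iter n avg (fun z => \sum_(i <- r) F i z) x = \sum_(i <- r) iter n avg (F i) x.
Proof.
elim: n x => [|n ih] x //=; rewrite -avg_sum; congr avg; apply/funext => z; exact: ih.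
Qed.

(** The heat kernel [P_x[X_n = y]], obtained without any probability measure; [srw_hk] makes the
    link. *)
Definition hk n x y : R := iter n avg (fun z => (z == y)%:R) x.

Lemma hkS n x y : hk n.+1 x y = avg (hk n ^~ y) x.
Proof. by []. Qed.

Lemma hk_ge0 n x y : 0 <= hk n x y.
Proof. by elim: n x => [|n ih] x; [exact: ler0n|exact: avg_ge0]. Qed.

Lemma hk_translate n x y z : hk n (x + z) (y + z) = hk n x y.
Proof.
elim: n x => [|n ih] x; first by rewrite /hk/= (inj_eq (addIr z)).
rewrite !hkS -avg_translate; congr avg; apply/funext => w; exact: ih.
Qed.

Lemma hk_opp n x y : hk n (- x) (- y) = hk n x y.
Proof.
elim: n x => [|n ih] x; first by rewrite /hk/= eqr_opp.
rewrite !hkS -avg_opp; congr avg; apply/funext => w; exact: ih.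
Qed.

(** Translation by [- (x + y)] sends the pair [(x, y)] to [(- y, - x)], and reflection sends this to
    [(y, x)]. *)
Lemma hkC n x y : hk n x y = hk n y x.
Proof.
rewrite -(hk_translate n x y (- (x + y))) opprD addrA subrr add0r.
by rewrite [- x - y]addrC addrA subrr add0r hk_opp.
Qed.

Lemma iter_avg_fset n (K : {fset lattice d}) f x : (forall z, z \notin K -> f z = 0) ->
  iter n avg f x = \sum_(y <- K) hk n x y * f y.
Proof.
move=> f0; under eq_bigr do rewrite mulrC -iter_avgZ.
rewrite -iter_avg_sum; congr (iter n avg _ x); apply/funext => z.
have [zK|zK] := boolP (z \in K).
  rewrite (big_fsetD1 z)//= eqxx mulr1 big_seq big1 ?addr0// => y.
  by rewrite in_fsetD1 eq_sym => /andP[/negPf -> _]; rewrite mulr0.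
rewrite f0// big_seq big1// => y yK; case: eqP => [zy|]; last by rewrite mulr0.
by rewrite zy yK in zK.
Qed.

(* The expectation of [a (X_0) ... a (X_(n - 1))] under the walk started at [x]. *)
Fixpoint fk a n x : R := if n is m.+1 then a x * avg (fk a m) x else 1.

(** One step is [1 - a * avg f = (1 - a) * avg f + avg (1 - f)], because averaging preserves
    constants; the last term is then iterated. *)
Lemma fk_telescope a n x : 1 - fk a n x =
  \sum_(k < n) iter k avg (fun z => (1 - a z) * avg (fk a (n - k.+1)) z) x.
Proof.
elim: n x => [|n ih] x; first by rewrite big_ord0 subrr.
rewrite big_ord_recl /= subSS subn0 -/(fk _ _).
have -> : \sum_(i < n) iter (lift ord0 i) avg
      (fun z => (1 - a z) * avg (fk a (n.+1 - (lift ord0 i).+1)) z) x =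
    avg (fun z => 1 - fk a n z) x.
  transitivity (avg (fun z => \sum_(k < n)
      iter k avg (fun z => (1 - a z) * avg (fk a (n - k.+1)) z) z) x).
    by rewrite avg_sum; apply: eq_bigr => i _; rewrite /= subSS.
  by congr avg; apply/funext => z; rewrite ih.
by rewrite avgB avg_cst; ring.
Qed.

Lemma fk_ge0 a n x : (forall z, 0 <= a z) -> 0 <= fk a n x.
Proof.
move=> a0; elim: n x => [|n ih] x //=; by rewrite mulr_ge0// avg_ge0.
Qed.

Lemma fk_le a n x : (forall z, 0 <= a z <= 1) -> fk a n.+1 x <= fk a n x.
Proof.
move=> a01; have a0 z : 0 <= a z by have /andP[] := a01 z.
elim: n x => [|n ih] x.
  by rewrite /= avg_cst mulr1; have /andP[] := a01 x.
by rewrite [leLHS]/= [leRHS]/= ler_wpM2l// le_avg.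
Qed.

(** The increment is the expectation of [a (X_0) ... a (X_(n - 1)) * (a (X_n) - 1)], bounded factor
    by factor. This transfers convergence from a monotone sequence to signed potentials. *)
Lemma fk_dist a b n x : (forall z, `|a z| <= b z) -> (forall z, `|a z - 1| <= b z - 1) ->
  `|fk a n.+1 x - fk a n x| <= fk b n.+1 x - fk b n x.
Proof.
move=> ab ab1; elim: n x => [|n ih] x; first by rewrite /= !avg_cst !mulr1.
rewrite [fk a n.+2 x]/= [fk a n.+1 x]/= [fk b n.+2 x]/= [fk b n.+1 x]/=.
rewrite -!mulrBr -!avgB normrM ler_pM//.
by apply: le_trans (ler_norm_avg _ _) _; exact: le_avg.
Qed.

End averaging.

Arguments avg {R d}.
Arguments fk {R d}.
Arguments hk R {d}.

(** * The Green function *)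

Lemma cvgn_unique (R : realType) (u : nat -> R) (l l' : R) :
  u n @[n --> \oo] --> l -> u n @[n --> \oo] --> l' -> l = l'.
Proof. by move=> ul ul'; rewrite -(cvg_lim _ ul)// -(cvg_lim _ ul'). Qed.

(** The sum is cut at [k = n - M]: for smaller [k] the value [f (n - k)] is close to [l], and the
    larger [k] carry only a tail of the summable [u], while [f - l] stays bounded. *)
Lemma cvg_convolution (R : realType) (u f : nat -> R) (l : R) :
    (forall k, 0 <= u k) -> cvgn (series u) -> f n @[n --> \oo] --> l ->
  \sum_(k < n) u k * f (n - k)%N @[n --> \oo] --> limn (series u) * l.
Proof.
move=> u0 cu fl; set U := limn (series u).
have ndu : nondecreasing_seq (series u).
  by apply/nondecreasing_seqP => n; rewrite seriesSr lerDl.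
have uU n : series u n <= U by exact: nondecreasing_cvgn_le.
have U0 : 0 <= U by rewrite (le_trans _ (uU 0%N))// /series/= big_geq.
have cfl : (fun n => f n - l) @ \oo --> 0.
  by rewrite -(subrr l); apply: cvgB => //; exact: cvg_cst.
have /ex_strict_bound_gt0[B B0 fB] : bounded_fun (fun n => f n - l).
  by apply: cvg_seq_bounded; apply/cvg_ex; exists 0.
suff cv : (fun n => \sum_(k < n) u k * (f (n - k)%N - l)) @ \oo --> 0.
  have -> : (fun n => \sum_(k < n) u k * f (n - k)%N) =
      (fun n => \sum_(k < n) u k * (f (n - k)%N - l) + series u n * l).
    apply/funext => n; rewrite /series/= big_mkord mulr_suml -big_split/=.
    by apply: eq_bigr => i _; ring.
  rewrite -[X in _ --> X]add0r; apply: cvgD => //.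
  by apply: cvgM => //; exact: cvg_cst.
apply/cvgrPdist_le => e e0.
(* The [+ 1] keeps the denominator positive when the total mass [U] is 0. *)
have e1 : 0 < e / (2 * (U + 1)) by rewrite divr_gt0// mulr_gt0// ltr_wpDl.
have e2 : 0 < e / (2 * B) by rewrite divr_gt0// mulr_gt0.
have [M _ hM] := (cvgrPdist_le _ _).1 cfl _ e1.
have [N _ hN] := (cvgrPdist_le _ _).1 cu _ e2.
exists (N + M)%N => // n /= NMn; rewrite sub0r normrN.
have Mn : (M <= n)%N by rewrite (leq_trans _ NMn)// leq_addl.
have NnM : (N <= n - M)%N by rewrite leq_subRL// addnC.
apply: (@le_trans _ _ (\sum_(0 <= k < n) u k * `|f (n - k)%N - l|)).
  rewrite big_mkord; apply: le_trans (ler_norm_sum _ _ _) _.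
  by apply: ler_sum => i _; rewrite normrM (ger0_norm (u0 _)).
rewrite (@big_cat_nat _ _ _ (n - M)%N)//= ?leq_subr//.
have -> : e = e / 2 + e / 2 by rewrite -splitr.
apply: lerD.
  apply: (@le_trans _ _ (\sum_(0 <= k < n - M) u k * (e / (2 * (U + 1))))).
    rewrite !big_nat; apply: ler_sum => k /andP[_ knM].
    by rewrite ler_wpM2l//; have := hM (n - k)%N; rewrite sub0r normrN; apply => /=; lia.
  rewrite -mulr_suml; apply: (@le_trans _ _ (U * (e / (2 * (U + 1))))).
    by apply: ler_wpM2r; [exact: ltW|exact: uU].
  have -> : U * (e / (2 * (U + 1))) = e / 2 - e / (2 * (U + 1)).
    by field; rewrite gt_eqF// ltr_wpDl.
  by rewrite lerBlDr lerDl ltW.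
apply: (@le_trans _ _ (\sum_(n - M <= k < n) u k * B)).
  by apply: ler_sum => k _; rewrite ler_wpM2l//; exact: ltW (fB (n - k)%N I).
rewrite -mulr_suml.
have -> : \sum_(n - M <= k < n) u k = series u n - series u (n - M)%N.
  by rewrite sub_series_geq ?leq_subr.
have /= := hN _ NnM; rewrite -/U ger0_norm ?subr_ge0// => h.
have {h} : series u n - series u (n - M)%N <= e / (2 * B).
  by apply: le_trans h; rewrite lerD2r.
move=> /(ler_wpM2r (ltW B0)); have -> // : e / (2 * B) * B = e / 2.
by field; rewrite gt_eqF.
Qed.

Lemma cvg_convolution_pred (R : realType) (u f : nat -> R) (l : R) :
    (forall k, 0 <= u k) -> cvgn (series u) -> f n @[n --> \oo] --> l ->
  \sum_(k < n) u k * f (n - k.+1)%N @[n --> \oo] --> limn (series u) * l.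
Proof.
move=> u0 cu fl.
under eq_fun do under eq_bigr do rewrite subnS.
apply: (@cvg_convolution _ _ (fun n => f n.-1)) => //.
by rewrite -cvg_shiftS.
Qed.

Section green_function.
Variables (R : realType) (d : nat).
Hypothesis d_gt0 : (0 < d)%N.
Implicit Types (x y z : lattice d) (K : {fset lattice d}) (V f : lattice d -> R).

Definition transient : Prop :=
  forall x y, cvgn (series (fun n => hk R n x y)).

(** It depends on [R] and [d] only, so the constant of the theorem can be built from it before the
    laws [P] are given. It is the Green function once the walk is transient; without convergence
    [limn] may be a default value. *)
Definition greenR x y : R := limn (series (fun n => hk R n x y)).

Lemma greenRC x y : greenR x y = greenR y x.
Proof. by rewrite /greenR; under eq_fun do rewrite hkC. Qed.

Hypothesis tr : transient.

Lemma nd_series_hk x y : nondecreasing_seq (series (fun n => hk R n x y)).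
Proof. by apply/nondecreasing_seqP => n; rewrite seriesSr lerDl hk_ge0. Qed.

Lemma series_hk_le_greenR n x y : series (fun n => hk R n x y) n <= greenR x y.
Proof. exact: nondecreasing_cvgn_le (nd_series_hk x y) (@tr x y) n. Qed.

Lemma greenR_ge0 x y : 0 <= greenR x y.
Proof. by apply: le_trans (series_hk_le_greenR 0 x y); rewrite /series/= big_geq. Qed.

Lemma greenR_step x y : greenR x y = (x == y)%:R + avg (greenR ^~ y) x.
Proof.
have h1 : avg (fun z => series (fun n => hk R n z y) n) x @[n --> \oo] -->
    avg (greenR ^~ y) x.
  by apply: cvg_avg => z; exact: tr.
have h2 : series (fun n => hk R n x y) n.+1 @[n --> \oo] --> greenR x y.
  by rewrite (cvg_shiftS (series (fun n => hk R n x y))); exact: tr.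
apply: (cvgn_unique h2).
have -> : (fun n => series (fun n => hk R n x y) n.+1) =
    (fun n => (x == y)%:R + avg (fun z => series (fun n => hk R n z y) n) x).
  apply/funext => n; rewrite /series/= big_nat_recl//= avg_sum//.
by apply: cvgD => //; exact: cvg_cst.
Qed.

(** [P^n G] is a tail of the Green series, hence tends to 0; this forces uniqueness in the case
    [V >= 0]. *)
Lemma iter_avg_greenR n x y :
  iter n avg (greenR ^~ y) x = greenR x y - series (fun n => hk R n x y) n.
Proof.
elim: n x => [|n ih] x; first by rewrite /series /= big_geq// subr0.
rewrite /= (funext ih) avgB [in RHS]greenR_step /series/= big_nat_recl//= avg_sum.
by rewrite opprD addrACA subrr add0r.
Qed.

(** Decomposition over the last time [k <= n] spent in [K]: the walk is then at some [x] and avoids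
    [K] during the next [n - k] steps. It falls out of the telescoping formula because the first
    factor of [fk] vanishes at [y]. *)
Lemma fk_last_exit K n y : y \in K ->
  \sum_(k < n.+1) \sum_(x <- K) hk R k y x *
     avg (fk (fun z => (z \notin K)%:R) (n.+1 - k.+1)) x = 1.
Proof.
move=> yK; set a := fun z => (z \notin K)%:R.
transitivity (1 - fk a n.+1 y); last by rewrite /= /a yK mul0r subr0.
rewrite fk_telescope//; apply: eq_bigr => k _.
rewrite (@iter_avg_fset _ _ _ K) /a => [|z /negPf ->]; last by rewrite subrr mul0r.
by rewrite !big_seq; apply: eq_bigr => z zK; rewrite zK subr0 mul1r.
Qed.

Lemma sum_greenR_escape K (e : lattice d -> R) y : y \in K ->
  {in K, forall x, avg (fk (fun z => (z \notin K)%:R) n) x @[n --> \oo] --> e x} ->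
  \sum_(x <- K) greenR y x * e x = 1.
Proof.
move=> yK ce; set a := fun z => (z \notin K)%:R in ce *.
have h : \sum_(x <- K) \sum_(k < n) hk R k y x * avg (fk a (n - k.+1)) x @[n --> \oo]
    --> \sum_(x <- K) greenR y x * e x.
  apply: cvg_sum_seq => x xK.
  by apply: (cvg_convolution_pred (f := fun n => avg (fk a n) x));
    [move=> k; exact: hk_ge0|exact: tr|exact: ce].
apply: (cvgn_unique h); rewrite -cvg_shiftS.
have -> : (fun n => \sum_(x <- K) \sum_(k < n.+1) hk R k y x *
    avg (fk a (n.+1 - k.+1)) x) = cst 1; last exact: cvg_cst.
by apply/funext => n; rewrite exchange_big fk_last_exit.
Qed.

(** For [a = 1 / (1 + V)] one has [1 - a = V * a], and this factor [a] completes
    [avg (fk a (n - k - 1))] to [fk a (n - k)]. *)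
Lemma fk_duhamel K V n x : (forall z, z \notin K -> V z = 0) -> (forall z, 1 + V z != 0) ->
  1 - fk (fun z => (1 + V z)^-1) n x =
  \sum_(k < n) \sum_(y <- K) hk R k x y * (V y * fk (fun z => (1 + V z)^-1) (n - k) y).
Proof.
move=> V0 V1; set a := fun z => _; rewrite fk_telescope//; apply: eq_bigr => k _.
rewrite (@iter_avg_fset _ _ _ K) => [|z zK]; last first.
  by rewrite /a V0// addr0 invr1 subrr mul0r.
apply: eq_bigr => y _; congr (_ * _); rewrite -(subnSK (ltn_ord k)) /= mulrA; congr (_ * _).
by rewrite /a mulrC; field; rewrite V1.
Qed.

Lemma fk_limit_eq K V (phi : lattice d -> R) x :
    (forall z, z \notin K -> V z = 0) -> (forall z, 1 + V z != 0) ->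
    (forall z, fk (fun z => (1 + V z)^-1) n z @[n --> \oo] --> phi z) ->
  phi x + \sum_(y <- K) greenR x y * (V y * phi y) = 1.
Proof.
move=> V0 V1 cphi; set a := fun z => _ in cphi *.
have h : \sum_(y <- K) \sum_(k < n) hk R k x y * (V y * fk a (n - k) y) @[n --> \oo]
    --> \sum_(y <- K) greenR x y * (V y * phi y).
  apply: cvg_sum_seq => y yK.
  apply: (cvg_convolution (f := fun n => V y * fk a n y)); [move=> k; exact: hk_ge0|exact: tr|].
  by apply: cvgM => //; exact: cvg_cst.
suff -> : \sum_(y <- K) greenR x y * (V y * phi y) = 1 - phi x by rewrite addrC subrK.
apply: (cvgn_unique h).
under eq_fun do rewrite exchange_big -fk_duhamel//.
by apply: cvgB => //; exact: cvg_cst.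
Qed.

(** [F = - G V f] extends [f] off [K], is harmonic there, and satisfies [avg F = (1 + V) F] on [K];
    as [V >= 0], [|F|] is subharmonic. So [|F| <= P^n |F|], which is at most a finite combination of
    tails of Green series and tends to 0. *)
Lemma greenR_kernel_ge0 K V f : (forall z, 0 <= V z) ->
    {in K, forall x, f x + \sum_(y <- K) greenR x y * (V y * f y) = 0} ->
  {in K, forall x, f x = 0}.
Proof.
move=> V0 fK; pose F x := - \sum_(y <- K) greenR x y * (V y * f y).
have FK : {in K, forall x, f x = F x}.
  by move=> x xK; apply/eqP; rewrite -subr_eq0 opprK fK.
have avgF x : avg F x = F x + \sum_(y <- K) (x == y)%:R * (V y * f y).
  rewrite /F.
  have -> : avg (fun x0 => - (\sum_(y <- K) greenR x0 y * (V y * f y))) x =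
     \sum_(y <- K) - (V y * f y) * avg (greenR ^~ y) x.
    under eq_bigr do rewrite -avgZ.
    rewrite -avg_sum; congr avg; apply/funext => z; rewrite -sumrN.
    by apply: eq_bigr => y _; ring.
  rewrite -sumrN -big_split/=; apply: eq_bigr => y _.
  by rewrite (greenR_step x y); ring.
have leF x : `|F x| <= avg (fun z => `|F z|) x.
  apply: le_trans (ler_norm_avg _ _); rewrite avgF.
  have [xK|xK] := boolP (x \in K).
    rewrite (big_fsetD1 x)//= eqxx mul1r big_seq big1 => [|y].
      rewrite addr0 FK// -{2}[F x]mul1r -mulrDl normrM ler_peMl//.
      by rewrite ger0_norm ?lerDl// addr_ge0.
    by rewrite in_fsetD1 eq_sym => /andP[/negPf -> _]; rewrite mul0r.
  rewrite big_seq big1 ?addr0// => y yK; case: eqP => [xy|]; last by rewrite mul0r.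
  by rewrite xy yK in xK.
have leFn n x : `|F x| <= iter n avg (fun z => `|F z|) x.
  elim: n x => [|n ih] x //; apply: le_trans (ih _) _.
  by rewrite -iter_avgS; exact: le_iter_avg.
move=> x xK; rewrite FK//; apply/eqP; rewrite -normr_le0.
have h : \sum_(y <- K) `|V y * f y| * iter n avg (greenR ^~ y) x @[n --> \oo] --> 0.
  rewrite [X in _ --> X](_ : _ = \sum_(y <- K) 0); last by rewrite big1.
  apply: cvg_sum_seq => y _; rewrite -[X in _ --> X](mulr0 `|V y * f y|).
  apply: cvgM; first exact: cvg_cst.
  under eq_fun do rewrite iter_avg_greenR.
  rewrite -(subrr (greenR x y)); apply: cvgB; [exact: cvg_cst|exact: tr].
apply: (cvgr_to_ge h).
apply: nearW => n; apply: le_trans (leFn n x) _.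
under eq_bigr do rewrite -iter_avgZ; rewrite -iter_avg_sum.
apply: le_iter_avg => z; rewrite normrN; apply: le_trans (ler_norm_sum _ _ _) _.
by apply: ler_sum => y _; rewrite normrM mulrC (ger0_norm (greenR_ge0 _ _)).
Qed.

(** Contraction in [l^1 (K)]: the norm [M] of a solution satisfies [M <= c * S * M], where [S] is
    the double sum of the Green function over [K]. *)
Lemma greenR_kernel_small K V f c :
    (forall z, `|V z| <= c) -> c * (\sum_(x <- K) \sum_(y <- K) greenR x y) < 1 ->
    {in K, forall x, f x + \sum_(y <- K) greenR x y * (V y * f y) = 0} ->
  {in K, forall x, f x = 0}.
Proof.
move=> Vc cG fK; set S := \sum_(x <- K) \sum_(y <- K) greenR x y in cG.
have c0 : 0 <= c by exact: le_trans (normr_ge0 _) (Vc 0).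
pose M := \sum_(x <- K) `|f x|.
have fM y : y \in K -> `|f y| <= M.
  by move=> yK; rewrite /M (big_fsetD1 y)//= lerDl sumr_ge0.
have : M <= c * S * M.
  rewrite {1}/M -mulrA mulr_suml mulr_sumr !big_seq; apply: ler_sum => x xK.
  have -> : f x = - \sum_(y <- K) greenR x y * (V y * f y).
    by apply/eqP; rewrite -subr_eq0 opprK fK.
  rewrite normrN mulr_suml mulr_sumr; apply: le_trans (ler_norm_sum _ _ _) _.
  rewrite !big_seq; apply: ler_sum => y yK.
  rewrite !normrM (ger0_norm (greenR_ge0 _ _)) mulrCA.
  by rewrite ler_pM ?mulr_ge0 ?greenR_ge0// ler_wpM2l ?greenR_ge0 ?fM.
have M0 : 0 <= M by exact: sumr_ge0.
move=> h; have {h M0} M0 : M = 0.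
  apply/eqP; rewrite eq_le M0 andbT leNgt; apply/negP => Mpos.
  by have := lt_le_trans cG; move: h; rewrite -ler_pdivrMr// divff ?gt_eqF// leNgt cG.
move=> x xK; apply/eqP; rewrite -normr_le0 -M0; exact: fM.
Qed.

Lemma fk_cvg_ge0 V x : (forall z, 0 <= V z) ->
  cvgn (fk (fun z => (1 + V z)^-1) ^~ x).
Proof.
move=> V0.
have a0 z : 0 <= (1 + V z)^-1 by rewrite invr_ge0 addr_ge0.
apply: nonincreasing_is_cvgn.
  apply/nonincreasing_seqP => n; apply: fk_le => // z; rewrite a0/=.
  by rewrite invf_le1 ?lerDl// ltr_wpDr.
by exists 0 => _ [n _ <-]; apply: fk_ge0.
Qed.

Lemma fk_nondecreasing V x : (forall z, 0 <= V z < 1) ->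
  nondecreasing_seq (fk (fun z => (1 - V z)^-1) ^~ x).
Proof.
move=> V01; have V1 z : 0 < 1 - V z by rewrite subr_gt0; have /andP[] := V01 z.
have V0 z : 0 <= V z by have /andP[] := V01 z.
have b0 z : `|(1 - V z)^-1| <= (1 - V z)^-1 by rewrite ger0_norm// invr_ge0 ltW.
have b1 z : `|(1 - V z)^-1 - 1| <= (1 - V z)^-1 - 1.
  by rewrite ger0_norm// subr_ge0 invf_ge1// gerBl.
apply/nondecreasing_seqP => n; rewrite -subr_ge0.
exact: le_trans (normr_ge0 _) (fk_dist d_gt0 n x b0 b1).
Qed.

(** A self-bounding estimate: Duhamel's formula for the potential [- V] bounds [psi n] through
    [M n], its own sum over [K]. Summation over [K] gives [M n <= |K| + c * S * M n], which can be
    solved for [M n] as [c * S < 1]. *)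
Lemma fk_bounded_small K V c x :
    (forall z, z \notin K -> V z = 0) -> (forall z, 0 <= V z <= c) -> c < 1 ->
    c * (\sum_(x <- K) \sum_(y <- K) greenR x y) < 1 ->
  exists B, forall n, fk (fun z => (1 - V z)^-1) n x <= B.
Proof.
move=> VK Vc c1 cG; set S := \sum_(x <- K) \sum_(y <- K) greenR x y in cG.
have V0 z : 0 <= V z by have /andP[] := Vc z.
have c0 : 0 <= c by have /andP[/le_trans] := Vc 0; apply.
have V1 z : 0 < 1 - V z.
  by rewrite subr_gt0 (le_lt_trans _ c1)//; have /andP[] := Vc z.
pose psi := fk (fun z => (1 - V z)^-1).
have psi0 n z : 0 <= psi n z by apply: fk_ge0 => [//|w]; rewrite invr_ge0 ltW.
have psi_nd z : nondecreasing_seq (psi ^~ z).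
  by apply: fk_nondecreasing => w; rewrite V0/= -subr_gt0.
pose M n := \sum_(y <- K) psi n y.
have psi_le_M n y : y \in K -> psi n y <= M n.
  by move=> yK; rewrite /M (big_fsetD1 y)//= lerDl sumr_ge0.
have psiM n z : psi n z <= 1 + c * (\sum_(y <- K) greenR z y) * M n.
  have h : 1 - psi n z =
      - \sum_(k < n) \sum_(y <- K) hk R k z y * (V y * psi (n - k)%N y).
    rewrite (@fk_duhamel K (fun z => - V z)) => [|w wK|w]; first 1 last.
    - by rewrite VK ?oppr0.
    - by rewrite gt_eqF.
    rewrite -sumrN; apply: eq_bigr => k _; rewrite -sumrN.
    by apply: eq_bigr => y _; rewrite !mulNr mulrN.
  rewrite -lerBlDl -opprB h opprK exchange_big -mulrA mulr_suml mulr_sumr /=.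
  rewrite !big_seq; apply: ler_sum => y yK.
  apply: (@le_trans _ _ (\sum_(k < n) hk R k z y * (c * M n))).
    apply: ler_sum => k _; rewrite ler_wpM2l ?hk_ge0// ler_pM//.
      by have /andP[] := Vc y.
    (* Monotonicity in time replaces [psi (n - k)] by [psi n], so that the convolution closes on
       [M n]. *)
    by apply: le_trans (psi_nd _ _ _ (leq_subr k n)) (psi_le_M _ _ yK).
  rewrite -mulr_suml mulrCA ler_wpM2l// ler_wpM2r ?sumr_ge0//.
  by have := series_hk_le_greenR n z y; rewrite /series/= big_mkord.
have cS : 0 < 1 - c * S by rewrite subr_gt0.
have Mle n : M n <= (size (K : seq _))%:R / (1 - c * S).
  rewrite ler_pdivlMr// mulrBr mulr1 lerBlDr.
  have : M n <= \sum_(z <- K) (1 + c * (\sum_(y <- K) greenR z y) * M n).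
    by apply: ler_sum => z _; exact: psiM.
  rewrite big_split /= big_const_seq count_predT iter_addr_0 -mulr_suml -mulr_sumr.
  by rewrite [M n * _]mulrC.
exists (1 + c * (\sum_(y <- K) greenR x y) * ((size (K : seq _))%:R / (1 - c * S))).
move=> n; apply: le_trans (psiM n x) _.
by rewrite lerD2l ler_wpM2l// mulr_ge0// sumr_ge0// => y _; exact: greenR_ge0.
Qed.

(** The increments are absolutely summable, being dominated by those of the bounded monotone
    sequence attached to [- W]. *)
Lemma fk_cvg_small V W B x :
    (forall z, `|V z| <= W z) -> (forall z, W z < 1) ->
    (forall n, fk (fun z => (1 - W z)^-1) n x <= B) ->
  cvgn (fk (fun z => (1 + V z)^-1) ^~ x).
Proof.
move=> VW W1 psiB; set psi := fk _ in psiB; set phi := fk _.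
have W01 z : 0 <= W z < 1 by rewrite (le_trans (normr_ge0 _) (VW z)) W1.
have cpsi : cvgn (psi ^~ x).
  apply: nondecreasing_is_cvgn; first exact: fk_nondecreasing.
  by exists B => _ [n _ <-].
suff h : cvgn (series (fun n => phi n.+1 x - phi n x)).
  have -> : phi ^~ x = (fun n => phi 0%N x + series (fun n => phi n.+1 x - phi n x) n).
    by apply/funext => n; rewrite /series/= telescope_sumr// addrC subrK.
  by apply: is_cvgD => //; exact: is_cvg_cst.
apply: normed_cvg.
apply: (@series_le_cvg _ _ (fun n => psi n.+1 x - psi n x)) => [n|n|n|].
- exact: normr_ge0.
- by rewrite subr_ge0; have /nondecreasing_seqP := fk_nondecreasing x W01; apply.
- apply: fk_dist => // z; have /andP[W0 _] := W01 z.
    have V1 : 0 < 1 + V z.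
      by move: (VW z) (W1 z); rewrite ler_norml => /andP[] h _ h'; lra.
    rewrite ger0_norm ?invr_ge0 ?(ltW V1)// lef_pV2 ?posrE ?subr_gt0//.
    by move: (VW z); rewrite ler_norml => /andP[h _]; lra.
  have V1 : 0 < 1 + V z.
    by move: (VW z) (W1 z); rewrite ler_norml => /andP[] h _ h'; lra.
  have W2 : 0 < 1 - W z by rewrite subr_gt0.
  have -> : (1 + V z)^-1 - 1 = - V z / (1 + V z) by field; rewrite gt_eqF.
  have -> : (1 - W z)^-1 - 1 = W z / (1 - W z) by field; rewrite gt_eqF.
  rewrite normrM normrN normfV ler_pM ?invr_ge0//.
  rewrite (gtr0_norm V1) lef_pV2 ?posrE//.
  by move: (VW z); rewrite ler_norml => /andP[h _]; lra.
- have -> : series (fun n => psi n.+1 x - psi n x) = (fun n => psi n x - psi 0%N x).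
    by apply/funext => n; rewrite /series/= telescope_sumr.
  by apply: is_cvgB => //; exact: is_cvg_cst.
Qed.

End green_function.

(** The telescoping formula for the set [{y}] bounds [e] times the expected number of visits to [y]
    by 1, from any starting point; translation moves the target. *)
Lemma escape_transient (R : realType) (d : nat) (y : lattice d) (e : R) :
    (0 < d)%N -> 0 < e ->
    (forall n, e <= avg (fk (fun z => (z \notin [fset y]%fset)%:R) n) y) ->
  transient R d.
Proof.
move=> d0 e0 he; set a := fun z => _ in he.
have h x : cvgn (series (fun n => hk R n x y)).
  apply: nondecreasing_is_cvgn.
    by apply/nondecreasing_seqP => n; rewrite seriesSr lerDl hk_ge0.
  exists e^-1 => _ [n _ <-]; rewrite -[leRHS]mul1r ler_pdivlMr//.
  apply: (@le_trans _ _ (1 - fk a n x)); last by rewrite gerBl fk_ge0.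
  rewrite fk_telescope// mulr_suml big_mkord; apply: ler_sum => k _.
  rewrite (@iter_avg_fset _ _ _ [fset y]%fset) => [|z zy]; last first.
    by rewrite /a zy subrr mul0r.
  rewrite big_seq_fset1 /a in_fset1 eqxx subr0 mul1r.
  by rewrite ler_wpM2l ?hk_ge0.
move=> x y'; have := h (x + (y - y')).
suff -> : (fun n => hk R n x y') = (fun n => hk R n (x + (y - y')) y) by [].
apply/funext => k; rewrite -(hk_translate R k x y' (y - y')).
by rewrite [y' + _]addrC subrK.
Qed.

(** * Integration against laws *)

Section integral_comp_law.
Context d1 d2 (T1 : measurableType d1) (T2 : measurableType d2) (R : realType).
Variables (mu : {measure set T1 -> \bar R}) (D : set T1) (mD : measurable D).
Import HBNNSimple.
Local Open Scope ereal_scope.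

(** The hypothesis says that the measure [G mu] on [D], pushed by [Y], is [c rho], but only on sets;
    simple functions extend it to [f]. [G] is the product of the other factors in one application
    and a density in another. *)
Lemma integral_comp_law (G : T1 -> R) (Y : T1 -> T2) (rho : probability T2 R) (c : R)
    (f : T2 -> R) :
    measurable_fun D G -> (forall x, 0 <= G x)%R -> measurable_fun D Y ->
    (forall C, measurable C ->
      \int[mu]_(x in D) (G x * \1_C (Y x))%:E = (c * fine (rho C))%:E) ->
    measurable_fun setT f -> (forall y, 0 <= f y)%R ->
  \int[mu]_(x in D) (G x * f (Y x))%:E = c%:E * \int[rho]_y (f y)%:E.
Proof.
move=> mG G0 mY hC mf f0.
have mEf : measurable_fun setT (EFin \o f) by exact/measurable_EFinP.
pose s := nnsfun_approx measurableT mEf.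
have s_f y : (s n y)%:E @[n --> \oo] --> (f y)%:E.
  by apply: (@cvg_nnsfun_approx _ _ _ _ measurableT _ mEf) => // x _; rewrite lee_fin.
have s_nd y : nondecreasing_seq (fun n => s n y).
  by move=> m n mn; have /lefP := nd_nnsfun_approx measurableT mEf mn; apply.
have c0 : (0 <= c)%R.
  rewrite -lee_fin -[c]mulr1 -[1%R]/(fine (1 : \bar R)) -(@probability_setT _ _ _ rho).
  rewrite -hC//; apply: integral_ge0 => x _; rewrite lee_fin mulr_ge0//.
have ms n : measurable_fun D (fun x => s n (Y x)).
  by apply: (measurableT_comp _ mY).
have simple n : \int[mu]_(x in D) (G x * s n (Y x))%:E =
    c%:E * \int[rho]_y (s n y)%:E.
  have m1 r : measurable (s n @^-1` [set r]) by exact: measurable_funPTI.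
  have mG1 r : measurable_fun D (fun x => G x * \1_(s n @^-1` [set r]) (Y x))%R.
    by apply: measurable_funM => //; apply: (measurableT_comp _ mY); exact: measurable_indic.
  have hr r : \int[mu]_(x in D) (r * (G x * \1_(s n @^-1` [set r]) (Y x)))%:E =
      (c * (r * fine (rho (s n @^-1` [set r]))))%:E.
    have [r0|r0] := leP 0%R r.
      under eq_integral do rewrite EFinM.
      rewrite ge0_integralZl_EFin//.
      - by rewrite hC// -EFinM mulrCA.
      - by move=> x _; rewrite lee_fin mulr_ge0.
      - exact/measurable_EFinP.
    rewrite preimage_nnfun0// measure0 mulr0 mulr0 integral0_eq// => x _.
    by rewrite indic0 !mulr0.
  under eq_integral.
    move=> x _; rewrite (fimfunE (s n) (Y x)) fsbig_finite//= mulr_sumr -sumEFin.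
    under eq_bigr do rewrite mulrCA.
    over.
  rewrite ge0_integral_sum//; last 2 first.
  - by move=> r; apply/measurable_EFinP; apply: measurable_funM.
  - move=> r x _; rewrite lee_fin mulrCA mulr_ge0// -lee_fin EFinM.
    exact: nnfun_muleindic_ge0.
  under eq_bigr do rewrite hr.
  rewrite integralT_nnsfun sintegralE fsbig_finite//= sumEFin -mulr_sumr EFinM.
  congr (_ * _); rewrite -sumEFin; apply: eq_bigr => r _.
  by rewrite EFinM fineK// fin_num_measure.
have cvl : \int[mu]_(x in D) (G x * s n (Y x))%:E @[n --> \oo] -->
    \int[mu]_(x in D) (G x * f (Y x))%:E.
  have -> : \int[mu]_(x in D) (G x * f (Y x))%:E =
      \int[mu]_(x in D) limn (fun n => (G x * s n (Y x))%:E).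
    apply: eq_integral => x _; apply/esym/cvg_lim => //.
    under eq_fun do rewrite EFinM.
    by rewrite EFinM; apply: cvgeZl.
  apply: cvg_monotone_convergence => //.
  - by move=> n; apply/measurable_EFinP; exact: measurable_funM.
  - by move=> n x _; rewrite lee_fin mulr_ge0.
  - by move=> x _ m n mn; rewrite lee_fin ler_wpM2l// s_nd.
have cvr : c%:E * \int[rho]_y (s n y)%:E @[n --> \oo] --> c%:E * \int[rho]_y (f y)%:E.
  apply: cvgeZl => //.
  have -> : \int[rho]_y (f y)%:E = \int[rho]_y limn (fun n => (s n y)%:E).
    by apply: eq_integral => y _; apply/esym/cvg_lim.
  apply: cvg_monotone_convergence => //.
  - by move=> n; apply/measurable_EFinP.
  - by move=> n y _; rewrite lee_fin.
  - by move=> y _ m n mn; rewrite lee_fin s_nd.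
by rewrite -(cvg_lim _ cvl)// (funext simple) (cvg_lim _ cvr).
Qed.

End integral_comp_law.

(** * Expectation of a product of independent factors *)

Section independence.
Context d1 d2 (T1 : measurableType d1) (T2 : measurableType d2) (R : realType).
Variables (mu : {measure set T1 -> \bar R}) (D : set T1) (mD : measurable D).
Variables (n : nat) (Y : 'I_n -> T1 -> T2) (rho : 'I_n -> probability T2 R) (c : R).
Hypothesis mY : forall j, measurable_fun setT (Y j).
Hypothesis indep : forall C : 'I_n -> set T2, (forall j, measurable (C j)) ->
  mu (D `&` [set x | forall j, C j (Y j x)]) = (c * \prod_j fine (rho j (C j)))%:E.

(** Induction on the number [m] of leading factors that may be arbitrary, the others being
    indicators, for which independence is given. The factor of index [m] is released by
    [integral_comp_law], whose hypothesis, with an indicator in its place, is the previous case. *)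
Lemma integral_prod_indep (f : 'I_n -> T2 -> R) (v : 'I_n -> R) :
    (forall j, measurable_fun setT (f j)) -> (forall j y, 0 <= f j y) ->
    (forall j, \int[rho j]_y (f j y)%:E = (v j)%:E)%E ->
  (\int[mu]_(x in D) (\prod_j f j (Y j x))%:E = (c * \prod_j v j)%:E)%E.
Proof.
suff claim m : forall (f : 'I_n -> T2 -> R) (v : 'I_n -> R),
    (forall j, measurable_fun setT (f j)) -> (forall j y, 0 <= f j y) ->
    (forall j, \int[rho j]_y (f j y)%:E = (v j)%:E)%E ->
    (forall j : 'I_n, (m <= j)%N -> exists2 C, measurable C & f j = \1_C) ->
    (\int[mu]_(x in D) (\prod_j f j (Y j x))%:E = (c * \prod_j v j)%:E)%E.
  move=> mf f0 fv; apply: (claim n) => // j; by rewrite leqNgt ltn_ord.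
elim: m => [|m ih] {}f {}v mf f0 fv h.
  have {h} /choice[C hC] : forall j, exists C, measurable C /\ f j = \1_C.
    by move=> j; have [C mC e] := h j isT; exists C.
  have fC j : f j = \1_(C j) by have [] := hC j.
  have mC j : measurable (C j) by have [] := hC j.
  have -> : \prod_j v j = \prod_j fine (rho j (C j)).
    apply: eq_bigr => j _; have := fv j; rewrite fC integral_indic// setIT.
    by move=> ->.
  rewrite -indep// setIC.
  have mE : measurable [set x | forall j, C j (Y j x)].
    have -> : [set x | forall j, C j (Y j x)] = \bigcap_(j in setT) (Y j @^-1` C j).
      by apply/seteqP; split=> x /= hx j; [move=> _|]; exact: hx.
    apply: fin_bigcap_measurable => // j _.
    by rewrite -[X in measurable X]setTI; exact: mY.
  rewrite -[RHS]integral_indic//; apply: eq_integral => x _; congr EFin.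
  rewrite indicE; case: (boolP (x \in _)) => [|/negP xE].
    by rewrite inE => xE; rewrite big1// => j _; rewrite fC indicE mem_set.
  have [j Cj] : exists j, ~ C j (Y j x).
    by apply/existsNP; move: xE; rewrite inE.
  by rewrite (bigD1 j)//= fC indicE memNset// mul0r.
have [nm|mn] := leqP n m.
  apply: ih => // j mj; have := ltn_ord j; by rewrite ltnNge (leq_trans nm).
pose j0 := Ordinal mn.
under eq_integral do rewrite (bigD1 j0)//= mulrC.
rewrite (bigD1 j0)//= [v j0 * _]mulrC mulrA EFinM -fv.
apply: (@integral_comp_law _ _ _ _ _ mu D mD
   (fun x => \prod_(j | j != j0) f j (Y j x)) (Y j0) (rho j0)) => //.
- under eq_fun do rewrite -big_filter.
  apply: measurable_prod => j _; apply: measurable_funTS.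
  exact: measurableT_comp (mf j) (mY j).
- by move=> x; apply: prodr_ge0.
- exact: measurable_funTS.
move=> C mC.
pose f' j := if j == j0 then \1_C else f j.
pose v' j := if j == j0 then fine (rho j0 C) else v j.
have v'E : \prod_j v' j = fine (rho j0 C) * \prod_(j | j != j0) v j.
  rewrite (bigD1 j0)//= /v' eqxx; congr (_ * _).
  by apply: eq_bigr => j /negPf ->.
have -> : c * \prod_(i < n | i != j0) v i * fine (rho j0 C) = c * \prod_j v' j.
  by rewrite v'E; ring.
rewrite -(ih f' v').
- apply: eq_integral => x _; congr EFin.
  rewrite [in RHS](bigD1 j0)//= /f' eqxx mulrC; congr (_ * _).
  by apply: eq_bigr => j /negPf ->.
- by move=> j; rewrite /f'; case: eqP => // _; exact: measurable_indic.
- by move=> j y; rewrite /f'; case: eqP.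
- move=> j; rewrite /f' /v'; case: eqP => // ->.
  by rewrite integral_indic// setIT fineK// fin_num_measure.
- move=> j mj; rewrite /f'; case: eqP => jj0; first by exists C.
  apply: h; rewrite ltn_neqAle mj andbT; apply/eqP => e; apply: jj0.
  exact: val_inj.
Qed.

End independence.

(** * Generating function of the Poisson law *)

Section poisson_generating.
Variable R : realType.

Lemma integral_poisson_pow (r a : R) : 0 <= r -> 0 <= a ->
  (\int[poisson_prob r 0]_k (a ^+ k)%:E = (expR (r * (a - 1)))%:E)%E.
Proof.
move=> r0 a0.
rewrite (_ : [set: nat] = \bigcup_k [set k]); last by apply/seteqP; split=> // k _; exists k.
rewrite ge0_integral_bigcup//=; last 2 first.
- by move=> k _; rewrite lee_fin exprn_ge0.
- by move=> i j _ _ [k [-> ->]].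
have E k : (\int[poisson_prob r 0]_(x in [set k]) (a ^+ x)%:E =
    (a ^+ k)%:E * poisson_prob r 0 [set k])%E.
  rewrite -integral_cst//; apply: eq_integral => x; rewrite inE /= => ->//.
rewrite (eq_eseriesr (fun k _ => E k)).
(* At rate 0, [poisson_prob] is by definition the Dirac mass at 0, not the series. *)
move: r0; rewrite le_eqVlt => /predU1P[r0|r0].
  rewrite -r0 mul0r expR0 nneseries_recl//; last first.
    by move=> k _; rewrite mule_ge0// lee_fin exprn_ge0.
  rewrite eseries0 => [|k k0 _]; rewrite /poisson_prob ltxx.
    by rewrite diracE mem_set// expr0 adde0 mule1.
  by rewrite diracE memNset ?mule0//= => k00; rewrite -k00 in k0.
rewrite (eq_eseriesr (g := fun k => ((expR (- r))%:E * (exp_coeff (r * a) k)%:E)%E)).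
  rewrite nneseriesZl; last first.
    by move=> k _; rewrite lee_fin exp_coeff_ge0// mulr_ge0// ltW.
  have -> : expR (r * (a - 1)) = expR (- r) * expR (r * a).
    by rewrite -expRD; congr expR; ring.
  rewrite EFinM; congr (_ * _)%E; rewrite expRE -EFin_lim; last first.
    rewrite /pseries/=; under eq_fun do rewrite mulrC.
    exact: is_cvg_series_exp_coeff.
  apply/congr_lim/funext => n /=; rewrite /pseries/= /series/= -sumEFin.
  by apply: eq_bigr => i _; rewrite /exp_coeff /= mulrC.
move=> k _; rewrite /poisson_prob r0 esum_set1 ?lee_fin ?poisson_pmf_ge0//.
rewrite /poisson_pmf r0 -!EFinM; congr EFin.
by rewrite /exp_coeff /= exprMn; ring.
Qed.

End poisson_generating.

Section negligible.
Context d (T : measurableType d) (R : realType).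
Variable mu : {measure set T -> \bar R}.
Import HBNNSimple.
Local Open Scope ereal_scope.

(** The integral is a supremum over simple functions below [f], and each of these can be cut to [D]
    without changing its integral. So arbitrary nonnegative [f] are covered, in particular
    functionals of the point configuration whose measurability is unknown. *)
Lemma ge0_integral_conegligible (D : set T) (f : T -> \bar R) :
  measurable D -> mu (~` D) = 0 -> (forall x, 0 <= f x) ->
  \int[mu]_x f x = \int[mu]_(x in D) f x.
Proof.
move=> mD D0 f0; rewrite ge0_integralTE// ge0_integralE//.
apply/eqP; rewrite eq_le; apply/andP; split.
  apply: ge_ereal_sup => _ [h hf <-].
  rewrite -integralT_nnsfun (@ge0_negligible_integral _ _ _ mu setT (~` D));
    [|exact: measurableC|exact: measurableT| | |exact: D0]; last 2 first.
  - exact/measurable_EFinP.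
  - by move=> x _; rewrite lee_fin.
  rewrite setTD setCK integral_mkcond.
  have -> : (EFin \o h) \_ D = EFin \o proj_nnsfun h mD.
    apply/funext => x; rewrite patchE /= mindicE.
    by case: ifP; rewrite (mulr0, mulr1).
  rewrite integralT_nnsfun; apply: ereal_sup_ubound; exists (proj_nnsfun h mD) => //= x.
  rewrite patchE mindicE; case: ifP => _; rewrite (mulr0, mulr1)//; exact: hf.
apply: ge_ereal_sup => _ [h hf <-]; apply: ereal_sup_ubound; exists h => //= x.
by apply: le_trans (hf x) _; rewrite patchE; case: ifP.
Qed.

End negligible.

(** * Poisson point processes *)

Section ereal_nat.
Variable R : realType.

(** The default 0 is harmless: on a set of finite intensity the count is almost surely a natural
    number. *)
Definition ereal_nat (y : \bar R) : nat := xget 0%N [set k | y = k%:R%:E].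

Lemma ereal_natE k : ereal_nat k%:R%:E = k.
Proof.
rewrite /ereal_nat; case: xgetP => [n _ /= e|/(_ k) /= []//].
by move/eqP: e; rewrite eqe eqr_nat => /eqP.
Qed.

Lemma measurable_ereal_nat : measurable_fun setT ereal_nat.
Proof.
have m1 k : measurable [set y : \bar R | y = k%:R%:E].
  exact: (emeasurable_set1 k%:R%:E).
move=> _ U _; rewrite setTI.
have -> : ereal_nat @^-1` U = (\bigcup_(k in U) [set y : \bar R | y = k%:R%:E]) `|`
    (if 0%N \in U then ~` (\bigcup_k [set y : \bar R | y = k%:R%:E]) else set0).
  apply/seteqP; split => y /=.
    rewrite /ereal_nat; case: xgetP => [k _ yk Uk|ny U0]; first by left; exists k.
    by right; rewrite mem_set// => -[k _]; exact: ny.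
  case=> [[k Uk ->]|]; first by rewrite ereal_natE.
  case: ifPn => // /set_mem U0 ny; rewrite /ereal_nat; case: xgetP => // k _ yk.
  by case: ny; exists k.
apply: measurableU; first by apply: bigcup_measurable.
case: ifP => // _; apply: measurableC; exact: bigcupT_measurable.
Qed.

End ereal_nat.

Section poisson_laplace.
Variable R : realType.
Context dO dT (Omega : measurableType dO) (T : measurableType dT).
Variables (Pr : probability Omega R) (pts : Omega -> nat -> T).
Variable mu : set T -> \bar R.
Hypothesis pp : poisson_process pts Pr mu.

Let mN A : measurable A -> measurable_fun setT (point_count R pts A).
Proof. by case: pp => + _ _ _; apply. Qed.

Lemma measurable_count_nat A : measurable A ->
  measurable_fun setT (fun o => ereal_nat (point_count R pts A o)).
Proof. by move=> mA; apply: measurableT_comp (@measurable_ereal_nat R) (mN mA). Qed.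

Let mNk A k : measurable A -> measurable [set o | point_count R pts A o = k%:R%:E].
Proof.
move=> mA; rewrite -[X in measurable X]setTI.
exact: (mN mA measurableT (emeasurable_set1 k%:R%:E)).
Qed.

Let count_sub A (U : set nat) : measurable A -> (mu A < +oo)%E ->
  Pr (\bigcup_(k in U) [set o | point_count R pts A o = k%:R%:E]) =
  poisson_prob (fine (mu A)) 0 U.
Proof.
move=> mA muA; have mF k : measurable
    (if k \in U then [set o | point_count R pts A o = k%:R%:E] else set0).
  by case: ifP => _; [exact: mNk|exact: measurable0].
have memF k w : (if k \in U then [set o | point_count R pts A o = k%:R%:E] else set0) w ->
    point_count R pts A w = k%:R%:E by case: ifP.
have memU (k m : nat) : (if k \in U then [set k] else set0) m -> m = k by case: ifP.
rewrite bigcup_mkcond measure_semi_bigcup//; last 2 first.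
- move=> i j _ _ [w [/memF e1 /memF e2]]; apply/eqP.
  by rewrite -(eqr_nat R) -eqe -e1 e2.
- exact: bigcupT_measurable.
have UE : U = \bigcup_k (if k \in U then [set k] else set0).
  by rewrite -bigcup_mkcond; apply/seteqP; split=> [k Uk|k [j Uj ->//]]; exists k.
rewrite [in RHS]UE.
rewrite measure_semi_bigcup//; last first.
  by move=> i j _ _ [k [/memU <- /memU <-]].
apply: eq_eseriesr => k _; case: ifP => _; last by rewrite !measure0.
by case: pp => _ + _ _; apply.
Qed.

(** The default value of [ereal_nat] can only add mass, which gives one inequality for every set.
    Applied to [U] and to its complement, with both laws of total mass 1, it forces equality. *)
Lemma count_nat_law A (U : set nat) : measurable A -> (mu A < +oo)%E ->
  Pr [set o | U (ereal_nat (point_count R pts A o))] =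
  poisson_prob (fine (mu A)) 0 U.
Proof.
move=> mA muA; set Y := fun o => ereal_nat (point_count R pts A o).
have mY V : measurable [set o | V (Y o)].
  by rewrite -[X in measurable X]setTI; exact: measurable_count_nat.
have ge V : (poisson_prob (fine (mu A)) 0 V <= Pr [set o | V (Y o)])%E.
  rewrite -count_sub//; apply: le_measure; rewrite ?inE//.
    by apply: bigcup_measurable => k _; exact: mNk.
  by move=> o [k Vk /= e]; rewrite /Y e ereal_natE.
apply/eqP; rewrite eq_le ge andbT.
have := ge (~` U); rewrite probability_setC//.
have -> : [set o | (~` U) (Y o)] = ~` [set o | U (Y o)] by [].
rewrite probability_setC; last exact: mY.
by rewrite leeD2lE// leeN2.
Qed.

Lemma ae_count_finite A : measurable A -> (mu A < +oo)%E ->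
  let D := \bigcup_k [set o | point_count R pts A o = k%:R%:E] in
  measurable D /\ Pr (~` D) = 0%E.
Proof.
move=> mA muA D; have mD : measurable D by apply: bigcupT_measurable => k; exact: mNk.
split=> //; rewrite probability_setC// /D count_sub// probability_setT subee//.
Qed.

(** Each point in [A] contributes 1 to the series, so a tail below 1 contains none. *)
Lemma finite_count_bound A w : (point_count R pts A w < +oo)%E ->
  exists M, forall i, (M <= i)%N -> ~ A (pts w i).
Proof.
move=> h.
have := @nneseries_tail_cvg _ (fun i => \d_(pts w i) A : \bar R) xpredT h
  (fun _ _ => measure_ge0 _ _).
move=> /fine_cvgP[[N1 _ h1] /cvgrPdist_lt /(_ _ ltr01)[N2 _ h2]].
exists (maxn N1 N2) => i; rewrite geq_max => /andP[/h1 /= fi /h2 /=].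
rewrite sub0r normrN => lt1 Ai; move: lt1; apply/negP; rewrite -leNgt.
apply: le_trans (ler_norm _); rewrite -lee_fin fineK//.
rewrite (nneseries_split _ 1)//= addn1 big_nat1 diracE mem_set//.
by rewrite leeDl// nneseries_ge0.
Qed.

Lemma count_bounded (A : set T) w M : (forall i, (M <= i)%N -> ~ A (pts w i)) ->
  point_count R pts A w = (\sum_(i < M) (pts w i \in A)%:R)%:E.
Proof.
move=> h; rewrite /point_count (nneseries_split _ M)//= add0n eseries0 => [|i Mi _].
  by rewrite adde0 big_mkord -sumEFin; apply: eq_bigr => i _; rewrite diracE.
by rewrite diracE memNset//; exact: h.
Qed.

Lemma count_nat_bounded (A : set T) w M : (forall i, (M <= i)%N -> ~ A (pts w i)) ->
  ereal_nat (point_count R pts A w) = (\sum_(i < M) (pts w i \in A))%N.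
Proof. by move=> /count_bounded ->; rewrite -natr_sum ereal_natE. Qed.

End poisson_laplace.

Section poisson_laplace_simple.
Variable R : realType.
Context dT (T : measurableType dT).
Variables (nu : {measure set T -> \bar R}) (H : set T) (mH : measurable H).
Hypothesis nuH : (nu H < +oo)%E.
Import HBNNSimple.

Let part (s : {nnsfun T >-> R}) (r : R) := H `&` s @^-1` [set r].

Let mpart s r : measurable (part s r).
Proof. by apply: measurableI => //; exact: measurable_funPTI. Qed.

Let nupart s r : nu (part s r) \is a fin_num.
Proof.
rewrite ge0_fin_numE//; apply: le_lt_trans nuH; apply: le_measure; rewrite ?inE//.
by move=> x [].
Qed.

Let integral_parts (s : {nnsfun T >-> R}) (c : R -> R) : (forall r, 0 <= c r) ->
  (\int[nu]_(x in H) (c (s x))%:E =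
   (\sum_(r <- fset_set (range s)) c r * fine (nu (part s r)))%:E)%E.
Proof.
move=> c0.
have ms r : measurable (s @^-1` [set r]) by exact: measurable_funPTI.
under eq_integral.
  move=> x _.
  have -> : c (s x) = \sum_(r <- fset_set (range s)) c r * \1_(s @^-1` [set r]) x.
    have sx : s x \in fset_set (range s) by rewrite in_fset_set// inE; exists x.
    rewrite (big_fsetD1 _ sx)/= indicE mem_set// mulr1 big_seq big1 ?addr0// => r.
    rewrite in_fsetD1 => /andP[rsx _]; rewrite indicE memNset ?mulr0//= => e.
    by rewrite e eqxx in rsx.
  rewrite -sumEFin; over.
rewrite ge0_integral_sum//.
- rewrite -sumEFin; apply: eq_bigr => r _; rewrite EFinM fineK; last exact: nupart.
  under eq_integral do rewrite EFinM.
  rewrite ge0_integralZl_EFin ?lee_fin//; first by rewrite integral_indic// setIC.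
  by apply/measurable_EFinP; exact: measurable_indic.
- by move=> r; apply/measurable_EFinP; apply: measurable_funM => //; exact: measurable_indic.
- by move=> r x _; rewrite lee_fin mulr_ge0.
Qed.

Lemma integral_nnsfun_parts (s : {nnsfun T >-> R}) :
  (\int[nu]_(x in H) (s x)%:E =
   (\sum_(r <- fset_set (range s)) r * fine (nu (H `&` s @^-1` [set r])))%:E)%E.
Proof.
transitivity (\int[nu]_(x in H) (`|s x|)%:E)%E.
  by apply: eq_integral => x _; rewrite ger0_norm.
rewrite (integral_parts _ (fun r => normr_ge0 r)); congr EFin.
apply: eq_big_seq => r; rewrite in_fset_set// inE => -[x _ <-].
by rewrite ger0_norm.
Qed.

Lemma measure_nnsfun_parts (s : {nnsfun T >-> R}) :
  nu H = (\sum_(r <- fset_set (range s)) fine (nu (H `&` s @^-1` [set r])))%:E.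
Proof.
rewrite -[LHS]mul1e -integral_cst// (integral_parts s (fun=> ler01)).
by congr EFin; apply: eq_bigr => r _; rewrite mul1r.
Qed.

End poisson_laplace_simple.

Lemma cvg_prod_seq (R : realType) (I : Type) (r : seq I) (P : pred I)
    (F : nat -> I -> R) (l : I -> R) : (forall i, F n i @[n --> \oo] --> l i) ->
  \prod_(i <- r | P i) F n i @[n --> \oo] --> \prod_(i <- r | P i) l i.
Proof.
move=> Fl; elim: r => [|i r ih].
  by rewrite big_nil; under eq_fun do rewrite big_nil; exact: cvg_cst.
rewrite big_cons; under eq_fun do rewrite big_cons.
by case: ifP => // _; apply: cvgM.
Qed.

Section poisson_product.
Variable R : realType.
Context dO dT (Omega : measurableType dO) (T : measurableType dT).
Variables (Pr : probability Omega R) (pts : Omega -> nat -> T * R).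
Variable mu : set (T * R) -> \bar R.
Hypothesis pp : poisson_process pts Pr mu.
Variables (nu : {measure set T -> \bar R}) (H : set T) (mH : measurable H).
Hypothesis nuH : (nu H < +oo)%E.
Variable u : R.
Hypothesis u0 : 0 <= u.
Let I : set R := [set` `[0, u]].
Hypothesis muE : forall B, measurable B -> mu (B `*` I) = (nu B * u%:E)%E.
Import HBNNSimple.

Let cell (s : {nnsfun T >-> R}) (r : R) : set (T * R) := (H `&` s @^-1` [set r]) `*` I.

Let mHs (s : {nnsfun T >-> R}) r : measurable (H `&` s @^-1` [set r]).
Proof. by apply: measurableI => //; exact: measurable_funPTI. Qed.

Let mcell s r : measurable (cell s r).
Proof. by apply: measurableX => //; exact: measurable_itv. Qed.

Let nuHs (s : {nnsfun T >-> R}) r : nu (H `&` s @^-1` [set r]) \is a fin_num.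
Proof.
rewrite ge0_fin_numE//; apply: le_lt_trans nuH.
by apply: le_measure; rewrite ?inE.
Qed.

Let mu_cell (s : {nnsfun T >-> R}) r : mu (cell s r) = (fine (nu (H `&` s @^-1` [set r])) * u)%:E.
Proof. by rewrite muE// EFinM fineK. Qed.

(** For finitely many points this is the product of [s] over the points in the window, but written
    with finitely many counts, which makes it measurable. A value [r] taken at no point contributes
    [r ^+ 0 = 1], also for [r = 0]. *)
Let Z (s : {nnsfun T >-> R}) (w : Omega) : R :=
  \prod_(r <- fset_set (range s)) r ^+ ereal_nat (point_count R pts (cell s r) w).

Let mZ s : measurable_fun setT (Z s).
Proof.
apply: measurable_prod => r _.
apply: (@measurableT_comp _ _ _ _ _ _ (fun k : nat => r ^+ k)) => //.
by apply: (measurable_count_nat pp).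
Qed.

Let integral_Z (s : {nnsfun T >-> R}) : (\int[Pr]_w (Z s w)%:E =
  (expR (u * (fine (\int[nu]_(x in H) (s x)%:E) - fine (nu H))))%:E)%E.
Proof.
set a : seq R := fset_set (range s).
have aP r : r \in a -> exists x, s x = r.
  by rewrite in_fset_set// inE => -[x _ <-]; exists x.
pose r_ (j : 'I_(size a)) := a`_j.
have r_ge0 j : 0 <= r_ j by rewrite /r_; have [x <-] := aP _ (mem_nth 0 (ltn_ord j)).
pose lam (j : 'I_(size a)) := fine (nu (H `&` s @^-1` [set r_ j])) * u.
have lam0 j : 0 <= lam j by rewrite mulr_ge0// fine_ge0.
have lamE j : fine (mu (cell s (r_ j))) = lam j by rewrite mu_cell.
have multy j : (mu (cell s (r_ j)) < +oo)%E by rewrite mu_cell ltry.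
pose Y (j : 'I_(size a)) w := ereal_nat (point_count R pts (cell s (r_ j)) w).
have mY j : measurable_fun setT (Y j) by exact: (measurable_count_nat pp).
have indep (C : 'I_(size a) -> set nat) : (forall j, measurable (C j)) ->
    Pr (setT `&` [set w | forall j, C j (Y j w)]) =
    (1 * \prod_j fine (poisson_prob (lam j) 0 (C j)))%:E.
  move=> mC; rewrite setTI mul1r.
  have [_ _ _] := pp; move=> /(_ _ (fun j => cell s (r_ j))
    (fun j => @ereal_nat R @^-1` C j)) -> //.
  - rewrite -prodEFin; apply: eq_bigr => j _.
    by rewrite (count_nat_law pp)// lamE fineK// fin_num_measure.
  - move=> i j _ _ [p [[[_ /= e1] _] [[_ /= e2] _]]]; apply/val_inj/eqP.
    by rewrite -(nth_uniq 0 (ltn_ord i) (ltn_ord j)) ?fset_uniq// -/(r_ i) -/(r_ j) -e1 e2.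
  - move=> j; rewrite -[X in measurable X]setTI; exact: measurable_ereal_nat.
have -> : (\int[Pr]_w (Z s w)%:E = \int[Pr]_w (\prod_j r_ j ^+ Y j w)%:E)%E.
  by apply: eq_integral => w _; rewrite /Z (big_nth 0) big_mkord.
rewrite (@integral_prod_indep _ _ _ _ _ Pr setT measurableT _ Y
  (fun j => poisson_prob (lam j) 0) 1 mY indep (fun j k => r_ j ^+ k)
  (fun j => expR (lam j * (r_ j - 1)))) => //; last 2 first.
- by move=> j k; rewrite exprn_ge0.
- by move=> j; exact: integral_poisson_pow.
rewrite mul1r -expR_sum; congr (expR _)%:E.
rewrite integral_nnsfun_parts// (measure_nnsfun_parts mH nuH s) /=.
rewrite -sumrB (big_nth 0) big_mkord mulr_sumr.
by apply: eq_bigr => j _; rewrite /lam /r_; ring.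
Qed.

Let Z_bounded (s : {nnsfun T >-> R}) w M : (forall i, (M <= i)%N -> ~ (H `*` I) (pts w i)) ->
  Z s w = \prod_(i < M | pts w i \in H `*` I) s (pts w i).1.
Proof.
move=> h.
have cnt r : ereal_nat (point_count R pts (cell s r) w) =
    (\sum_(i < M) (pts w i \in cell s r))%N.
  by apply: count_nat_bounded => i Mi; apply: contra_not (h i Mi) => -[[]].
rewrite /Z; under eq_bigr do rewrite cnt expr_sum.
rewrite exchange_big [RHS]big_mkcond /=; apply: eq_bigr => i _.
case: ifPn => [|iH].
  rewrite inE => -[iH iI].
  have sx : s (pts w i).1 \in fset_set (range s).
    by rewrite in_fset_set// inE; exists (pts w i).1.
  rewrite (big_fsetD1 _ sx)/= mem_set// expr1 big_seq big1 ?mulr1// => r.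
  rewrite in_fsetD1 => /andP[rsx _]; rewrite memNset ?expr0// => -[[_ /= e] _].
  by rewrite e eqxx in rsx.
rewrite big1// => r _; rewrite memNset ?expr0// => -[[iH' _] iI].
by move: iH; rewrite notin_setE => -[].
Qed.

(** [f] is prescribed only where finitely many points fall in the window, an almost sure event.
    Simple functions increase to [h]; all factors being nonnegative, the products over points
    increase as well, so monotone convergence applies whether [h] is below or above 1. *)
Lemma poisson_product (h : T -> R) (v : R) (f : Omega -> \bar R) :
    measurable_fun setT h -> (forall x, 0 <= h x) ->
    (\int[nu]_(x in H) (h x)%:E = v%:E)%E ->
    (forall w, 0 <= f w)%E ->
    (forall w M, (forall i, (M <= i)%N -> ~ (H `*` I) (pts w i)) ->
      f w = (\prod_(i < M | pts w i \in H `*` I) h (pts w i).1)%:E) ->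
  (\int[Pr]_w f w = (expR (u * (v - fine (nu H))))%:E)%E.
Proof.
move=> mh h0 hv f0 fE.
have mEh : measurable_fun setT (EFin \o h) by exact/measurable_EFinP.
pose s := nnsfun_approx measurableT mEh.
have s_h y : s n y @[n --> \oo] --> h y.
  have : (s n y)%:E @[n --> \oo] --> (h y)%:E.
    by apply: (@cvg_nnsfun_approx _ _ _ _ measurableT _ mEh) => // x _; rewrite lee_fin.
  by move=> /fine_cvgP[_].
have s_nd y : nondecreasing_seq (fun n => s n y).
  by move=> m n mn; have /lefP := nd_nnsfun_approx measurableT mEh mn; apply.
have mHI : measurable (H `*` I) by apply: measurableX => //; exact: measurable_itv.
have muHI : (mu (H `*` I) < +oo)%E.
  by rewrite muE// -(@fineK _ (nu H)) ?ge0_fin_numE// -EFinM ltry.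
have [mD D0] := ae_count_finite pp mHI muHI; set D := \bigcup_k _ in mD D0.
have DM w : D w -> exists M, forall i, (M <= i)%N -> ~ (H `*` I) (pts w i).
  move=> [k _ /= e].
  have h1 : (point_count R pts (H `*` I) w < +oo)%E by rewrite e ltry.
  exact: (finite_count_bound h1).
have Z0 n w : 0 <= Z (s n) w.
  rewrite /Z big_seq prodr_ge0// => r; rewrite in_fset_set// inE => -[x _ <-].
  by rewrite exprn_ge0.
rewrite (ge0_integral_conegligible mD)//.
have cl : (\int[Pr]_(w in D) (Z (s n) w)%:E @[n --> \oo] --> \int[Pr]_(w in D) f w)%E.
  have -> : (\int[Pr]_(w in D) f w = \int[Pr]_(w in D) limn (fun n => (Z (s n) w)%:E))%E.
    apply: eq_integral => w; rewrite inE => /DM[M hM]; apply/esym/cvg_lim => //.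
    rewrite (fE _ _ hM); apply: cvg_EFin; first exact: nearW.
    under eq_fun do rewrite /= (Z_bounded _ hM).
    by apply: cvg_prod_seq => i; exact: s_h.
  apply: cvg_monotone_convergence => //.
  - by move=> n; apply/measurable_EFinP; exact: measurable_funTS.
  - by move=> n w _; rewrite lee_fin.
  - move=> w /DM[M hM] m n mn; rewrite lee_fin !(Z_bounded _ hM).
    by apply: ler_prod => i _; rewrite s_nd// andbT.
have cs : (\int[nu]_(x in H) (s n x)%:E @[n --> \oo] --> v%:E)%E.
  rewrite -hv.
  have -> : (\int[nu]_(x in H) (h x)%:E = \int[nu]_(x in H) limn (fun n => (s n x)%:E))%E.
    apply: eq_integral => y _; apply/esym/cvg_lim => //; apply: cvg_EFin.
      exact: nearW.
    exact: s_h.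
  apply: cvg_monotone_convergence => //.
  - by move=> n; apply/measurable_EFinP; exact: measurable_funTS.
  - by move=> n y _; rewrite lee_fin.
  - by move=> y _ m n mn; rewrite lee_fin s_nd.
have cr : ((expR (u * (fine (\int[nu]_(x in H) (s n x)%:E) - fine (nu H))))%:E
    @[n --> \oo] --> (expR (u * (v - fine (nu H))))%:E)%E.
  apply: cvg_EFin; first exact: nearW.
  apply: continuous_cvg; first exact: continuous_expR.
  apply: cvgM; first exact: cvg_cst.
  apply: cvgB; last exact: cvg_cst.
  by move/fine_cvgP : cs => [].
rewrite -(cvg_lim _ cl)// -(cvg_lim _ cr)//; apply/congr_lim/funext => n.
rewrite -integral_Z (ge0_integral_conegligible mD D0)// => w.
by rewrite lee_fin.
Qed.

End poisson_product.

(** * Events of the simple random walk *)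

Section walk_events.
Variable d : nat.
Implicit Types (p : nat -> lattice d) (B : set (lattice d)).

Lemma measurable_coordinate n B : measurable [set X : walk d | B (X n)].
Proof. by apply: sub_sigma_algebra; exists n, B. Qed.

Definition cyl n p : set (walk d) := [set X | forall k, (k <= n)%N -> X k = p k].

Lemma measurable_cyl n p : measurable (cyl n p).
Proof.
have -> : cyl n p = \bigcap_(k in [set k | (k <= n)%N]) [set X : walk d | X k = p k].
  by apply/seteqP; split=> X h k kn; exact: h.
apply: bigcap_measurable; first by exists 0%N.
by move=> k _; exact: (measurable_coordinate k [set p k]).
Qed.

Definition extend n p (y : lattice d) : nat -> lattice d :=
  fun k => if (k <= n)%N then p k else y.

Lemma cyl_extend n p y : cyl n.+1 (extend n p y) = cyl n p `&` [set X | X n.+1 = y].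
Proof.
apply/seteqP; split=> [X h|X [h hy] k kn].
  split=> [k kn|/=]; first by rewrite h ?(leqW kn)// /extend kn.
  by rewrite h// /extend ltnn.
rewrite /extend; case: ifPn => [|]; first exact: h.
by rewrite -ltnNge => nk; have -> : k = n.+1 by apply/eqP; rewrite eqn_leq kn.
Qed.

End walk_events.

Section srw.
Variables (R : realType) (d : nat) (P : lattice d -> probability (walk d) R).
Hypothesis d_gt0 : (0 < d)%N.
Hypothesis srwP : srw_laws P.
Implicit Types (x y z : lattice d) (p : nat -> lattice d).

Lemma srw_cyl0 x p : P x (cyl 0 p) = ((p 0%N == x)%:R)%:E.
Proof. by rewrite srwP big_ord0 mulr1. Qed.

Lemma srw_cylS x n p y : P x (cyl n.+1 (extend n p y)) =
  (P x (cyl n p) * ((y - p n \in steps d)%:R / (2 * d)%:R)%:E)%E.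
Proof.
rewrite !srwP -EFinM big_ord_recr/= mulrA adjacentE /extend leqnn ltnn.
congr (_ * _ * _)%:E; apply: eq_bigr => k _.
by rewrite (ltnW (ltn_ord k)) (ltn_ord k).
Qed.

(** [walk d] contains all sequences, so the next position is a neighbour only up to a null set: the
    [2 d] extended cylinders already carry the whole mass of the cylinder. *)
Lemma srw_step x n p (E : set (walk d)) : measurable E -> E `<=` cyl n p ->
  P x E = (\sum_(s <- steps d) P x (E `&` [set X | X n.+1 = (p n + s)%R]))%E.
Proof.
move=> mE Ecyl; pose C s := cyl n p `&` [set X : walk d | X n.+1 = p n + s].
have mC s : measurable (C s).
  by rewrite /C -cyl_extend; exact: measurable_cyl.
have PU (F : set (walk d)) : measurable F ->
    P x (F `&` \big[setU/set0]_(s <- steps d) C s) =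
    (\sum_(s <- steps d) P x (F `&` C s))%E.
  move=> mF; rewrite big_distrr/= -(@bigcup_seq _ _ (steps d) (fun s => F `&` C s)).
  rewrite measure_fin_bigcup//.
  - by rewrite -fsbig_seq ?uniq_steps.
  - move=> s t _ _ [X [[_ [_ /= e1]] [_ [_ /= e2]]]].
    by apply: (addrI (p n)); rewrite -e1 -e2.
  - by move=> s _; apply: measurableI.
have mU : measurable (\big[setU/set0]_(s <- steps d) C s).
  by apply: bigsetU_measurable.
have UC : \big[setU/set0]_(s <- steps d) C s `<=` cyl n p.
  by rewrite -bigcup_seq => X [s _ []].
have null : P x (cyl n p `\` \big[setU/set0]_(s <- steps d) C s) = 0%E.
  rewrite measureD//; last 2 first.
  - exact: measurable_cyl.
  - by rewrite -ge0_fin_numE// fin_num_measure//; exact: measurable_cyl.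
  transitivity (P x (cyl n p) - \sum_(s <- steps d) P x (cyl n p `&` C s))%E.
    congr (_ - _)%E; exact: PU (measurable_cyl n p).
  have -> : (\sum_(s <- steps d) P x (cyl n p `&` C s) = P x (cyl n p))%E.
    transitivity (\sum_(s <- steps d) P x (cyl n p) * ((2 * d)%:R^-1)%:E)%E.
      apply: eq_big_seq => s sS; rewrite /C setIA setIid -cyl_extend srw_cylS.
      by rewrite addrAC subrr add0r sS mul1r.
    rewrite -ge0_sume_distrr//.
    rewrite sumEFin big_const_seq count_predT size_steps iter_addr_0
      -[_^-1 *+ _]mulr_natr mulVf ?mule1//.
    by rewrite pnatr_eq0 muln_eq0 /= -lt0n.
  by rewrite subee// fin_num_measure//; exact: measurable_cyl.
have E0 : P x (E `\` \big[setU/set0]_(s <- steps d) C s) = 0%E.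
  apply: (@subset_measure0 _ _ _ (P x) _
    (cyl n p `\` \big[setU/set0]_(s <- steps d) C s)) => //.
  - exact: measurableD.
  - by apply: measurableD => //; exact: measurable_cyl.
  - by move=> X [/Ecyl EX nX]; split.
transitivity (P x (E `\` \big[setU/set0]_(s <- steps d) C s) +
    P x (E `&` \big[setU/set0]_(s <- steps d) C s))%E.
  exact: measureDI.
rewrite E0 add0e PU//; apply: eq_bigr => s _; congr (P x _).
apply/seteqP; split=> [X [EX [_ e]]//|X [EX e]]; split=> //; split=> //.
exact: Ecyl.
Qed.

(* Probability that the walk started at [y] is in [B j] at time [j.+1], for [j < m]. *)
Fixpoint visit_prob (B : nat -> {pred lattice d}) m y : R :=
  if m is m'.+1 then
    avg (fun z => (z \in B 0%N)%:R * visit_prob (fun j => B j.+1) m' z) y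
  else 1.

Lemma visit_prob_ge0 B m y : 0 <= visit_prob B m y.
Proof.
elim: m B y => [|m ih] B y //=; apply: avg_ge0 => // z.
by rewrite mulr_ge0.
Qed.

Definition visits n p m (B : nat -> {pred lattice d}) : set (walk d) :=
  cyl n p `&` [set X | forall j, (j < m)%N -> X (n + j.+1)%N \in B j].

Lemma measurable_visits n p m B : measurable (visits n p m B).
Proof.
apply: measurableI; first exact: measurable_cyl.
have -> : [set X : walk d | forall j, (j < m)%N -> X (n + j.+1)%N \in B j] =
    \bigcap_j (if (j < m)%N then [set X : walk d | [set y | y \in B j] (X (n + j.+1)%N)]
      else setT).
  apply/seteqP; split=> X h j; first by move=> _; case: ifPn => // /h.
  by move=> jm; have := h j I; rewrite jm.
apply: bigcapT_measurable => j; case: ifP => _ //; exact: measurable_coordinate.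
Qed.

(** The Markov property at time [n], obtained from cylinder probabilities alone: fixing the next
    position turns a visit constraint into a longer cylinder. *)
Lemma srw_visits x n p m B :
  P x (visits n p m B) = (P x (cyl n p) * (visit_prob B m (p n))%:E)%E.
Proof.
elim: m n p B => [|m ih] n p B.
  rewrite mule1; congr (P x _); apply/seteqP; split=> [X []//|X h]; by split.
rewrite (@srw_step x n p)//; [|exact: measurable_visits|by move=> X []].
rewrite /= /avg mulr_suml -sumEFin.
transitivity (\sum_(s <- steps d) P x (cyl n p) *
    (((p n + s \in B 0%N)%:R * visit_prob (fun j => B j.+1) m (p n + s)) / (2 * d)%:R)%:E)%E.
  apply: eq_big_seq => s sS.
  case: (boolP (p n + s \in B 0%N)) => sB; last first.
    rewrite mul0r mul0r mule0.
    rewrite (_ : _ `&` _ = set0) ?measure0//; apply/seteqP; split=> // X [[_ hX] /= e].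
    by have := hX 0%N isT; rewrite addn1 e (negPf sB).
  have -> : visits n p m.+1 B `&` [set X | X n.+1 = p n + s] =
      visits n.+1 (extend n p (p n + s)) m (fun j => B j.+1).
    rewrite /visits cyl_extend; apply/seteqP; split=> X /=.
      by move=> [[cX hX] e]; split=> // j jm; rewrite addSnnS; exact: hX.
    move=> [[cX e] hX]; split=> //; split=> // -[|j] jm; first by rewrite addn1 e.
    by rewrite -addSnnS; exact: hX.
  rewrite ih srw_cylS addrAC subrr add0r sS /extend ltnn -muleA -EFinM.
  by congr (_ * _%:E)%E; ring.
rewrite ge0_sume_distrr// => s _.
by rewrite lee_fin divr_ge0// mulr_ge0// visit_prob_ge0.
Qed.

Lemma srw_visits0 x m B :
  P x [set X | forall j, (j < m)%N -> X j.+1 \in B j] = (visit_prob B m x)%:E.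
Proof.
have mE : measurable [set X : walk d | forall j, (j < m)%N -> X j.+1 \in B j].
  have -> : [set X : walk d | forall j, (j < m)%N -> X j.+1 \in B j] =
      \bigcap_j (if (j < m)%N then [set X : walk d | [set y | y \in B j] (X j.+1)]
        else setT).
    apply/seteqP; split=> X h j; first by move=> _; case: ifPn => // /h.
    by move=> jm; have := h j I; rewrite jm.
  apply: bigcapT_measurable => j; case: ifP => _ //; exact: measurable_coordinate.
(* The walk starts at [x] almost surely, so intersecting with this cylinder changes no
   probability. *)
have c1 : P x (cyl 0 (fun=> x)) = 1%E by rewrite srw_cyl0 eqxx.
have mc := measurable_cyl 0 (fun=> x).
rewrite (measureDI _ mE mc) [X in (X + _)%E](_ : _ = 0%E) ?add0e.
  rewrite setIC; have -> : cyl 0 (fun=> x) `&`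
     [set X : walk d | forall j, (j < m)%N -> X j.+1 \in B j] = visits 0 (fun=> x) m B.
    by [].
  by apply: eq_trans (srw_visits x 0 (fun=> x) m B) _; rewrite c1 mul1e.
apply: (@subset_measure0 _ _ _ (P x) _ (~` cyl 0 (fun=> x))).
- exact: measurableD.
- exact: measurableC.
- by move=> X [].
- by apply: eq_trans (probability_setC (P x) mc) _; rewrite c1 subee.
Qed.

Lemma srw_hk n x y : P x [set X | X n = y] = (hk R n x y)%:E.
Proof.
case: n => [|n].
  have -> : [set X : walk d | X 0%N = y] = cyl 0 (fun=> y).
    apply/seteqP; split=> X /= => [e [|]//|]; exact.
  by rewrite srw_cyl0 eq_sym.
(* Index [j] stands for time [j.+1], so only time [n.+1] is constrained. *)
pose B (n j : nat) : {pred lattice d} := if j == n then pred1 y else predT.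
have -> : [set X : walk d | X n.+1 = y] =
    [set X : walk d | forall j, (j < n.+1)%N -> X j.+1 \in B n j].
  apply/seteqP; split=> X /= => [e j jn|/(_ n (ltnSn n))].
    by rewrite /B; case: eqP => [->|//]; rewrite e inE.
  by rewrite /B eqxx inE => /eqP.
rewrite srw_visits0; congr EFin; rewrite hkS.
elim: n x => [|n ih] x /=.
  by congr avg; apply/funext => z; rewrite /B /= inE mulr1.
congr avg; apply/funext => z; transitivity (visit_prob (B n) n.+1 z); last exact: ih.
by rewrite /= mul1r.
Qed.

Lemma srw_escape (K : {fset lattice d}) m x :
  P x [set X | forall n, (1 <= n <= m)%N -> X n \notin K] =
  (avg (fk (fun z => (z \notin K)%:R) m) x)%:E.
Proof.
have -> : [set X : walk d | forall n, (1 <= n <= m)%N -> X n \notin K] =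
    [set X : walk d | forall j, (j < m)%N -> X j.+1 \in [predC K]].
  apply/seteqP; split=> X /= h j; first by move=> jm; rewrite inE h.
  by case: j => // j jm; have := h j jm; rewrite inE.
rewrite (srw_visits0 _ _ (fun=> [predC K])); congr EFin.
elim: m x => [|m ih] x /=; first by rewrite avg_cst.
congr avg; apply/funext => z; by rewrite ih inE.
Qed.

Lemma measurable_no_return (K : {fset lattice d}) : measurable (@no_return d K).
Proof.
have -> : @no_return d K = \bigcap_n (if (1 <= n)%N then
    [set X : walk d | [set y | y \notin K] (X n)] else setT).
  apply/seteqP; split=> X h n; first by move=> _; case: ifPn => // /h.
  by move=> n1; have := h n I; rewrite n1.
apply: bigcapT_measurable => j; case: ifP => _ //; exact: measurable_coordinate.
Qed.

Lemma measurable_no_return_upto (K : {fset lattice d}) m :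
  measurable [set X : walk d | forall n, (1 <= n <= m)%N -> X n \notin K].
Proof.
have -> : [set X : walk d | forall n, (1 <= n <= m)%N -> X n \notin K] =
    \bigcap_n (if (1 <= n <= m)%N then
      [set X : walk d | [set y | y \notin K] (X n)] else setT).
  apply/seteqP; split=> X h n; first by move=> _; case: ifPn => // /h.
  by move=> n1; have := h n I; rewrite n1.
by apply: bigcapT_measurable => j; case: ifP => _ //; exact: measurable_coordinate.
Qed.

Lemma cvg_escape (K : {fset lattice d}) x :
  avg (fk (fun z => (z \notin K)%:R) n) x @[n --> \oo] --> fine (P x (no_return K)).
Proof.
pose F m := [set X : walk d | forall n, (1 <= n <= m)%N -> X n \notin K].
have mF m : measurable (F m) by exact: measurable_no_return_upto.
have FE : no_return K = \bigcap_m F m.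
  apply/seteqP; split=> X h n; first by move=> _ j /andP[j1 _]; exact: h.
  by move=> n1; apply: (h n I); rewrite n1 leqnn.
have : P x (F n) @[n --> \oo] --> P x (\bigcap_m F m).
  apply: nonincreasing_cvg_mu => //.
  - by rewrite -ge0_fin_numE// fin_num_measure.
  - exact: bigcapT_measurable.
  - move=> m n mn; apply/subsetPset => X h j /andP[j1 jm]; apply: h.
    by rewrite j1 (leq_trans jm).
have fin : P x (no_return K) \is a fin_num.
  by apply: fin_num_measure; exact: measurable_no_return.
rewrite -FE -(fineK fin) => /fine_cvgP[_].
suff -> : fine \o (fun n => P x (F n)) =
    (fun n => avg (fk (fun z => (z \notin K)%:R) n) x) by [].
by apply/funext => n /=; rewrite srw_escape.
Qed.

Lemma green_greenR x y : transient R d -> green P x y = greenR R x y.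
Proof.
move=> tr; rewrite /green /greenR.
under eq_eseriesr do rewrite srw_hk.
rewrite (_ : (\sum_(0 <= i <oo) (hk R i x y)%:E)%E = (limn (series (fun n => hk R n x y)))%:E)//.
rewrite -EFin_lim; last exact: tr.
by apply/congr_lim/funext => n /=; rewrite /series/= sumEFin.
Qed.

End srw.

(** * Local times of trajectories *)

Lemma esum_int (R : realType) (a : int -> \bar R) : (forall n, 0 <= a n)%E ->
  (\esum_(n in [set: int]) a n =
   \sum_(0 <= n <oo) a n%:Z + \sum_(0 <= n <oo) a (Negz n))%E.
Proof.
move=> a0.
rewrite (esumID (range Posz))//.
rewrite setTI [X in (_ + X)%E](_ : _ = \esum_(n in range Negz) a n)%E.
  rewrite (esum_image setT Posz) => [|m n _ _ [//]].
  rewrite (esum_image setT Negz) => [|m n _ _ [//]].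
  by rewrite !nneseries_esumT.
congr esum; apply/seteqP; split => -[n|n] /=.
- by move=> [_ []]; exists n.
- by move=> _; exists n.
- by case.
- by move=> _; split=> // -[].
Qed.

Section local_time.
Variables (R : realType) (d : nat) (d3 : (3 <= d)%N).
Local Notation W := (What R d3).
Implicit Types (w : W) (x y : lattice d) (K : {fset lattice d}) (V : lattice d -> R).

Lemma wgt_gt0 w n : 0 < wgt w n.
Proof. by have [h _ _ _ _] := svalP w; exact: h. Qed.

Definition local_time x w : \bar R :=
  (\esum_(n in [set: int]) (wgt w n * (pos w n == x)%:R)%:E)%E.

Lemma local_time_fin x w : local_time x w \is a fin_num.
Proof.
have [_ _ fin _ _] := svalP w; have {fin} := fin [fset x]%fset.
set A := [set n | _] => fA.
rewrite /local_time (esumID A) => [|n _]; last first.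
  by rewrite lee_fin mulr_ge0// ltW// wgt_gt0.
rewrite !setTI esum_fset => [|//|n _]; last first.
  by rewrite lee_fin mulr_ge0// ltW// wgt_gt0.
rewrite [X in (_ + X)%E]esum1 => [|n].
  rewrite adde0 fsumEFin//.
by rewrite /A /= in_fset1 => /negP/negPf; rewrite /pos => ->; rewrite mulr0.
Qed.

Lemma measurable_sval n (B : set (lattice d * R)) : measurable B ->
  measurable [set w : W | B (sval w n)].
Proof. by move=> mB; apply: sub_sigma_algebra; exists n, B. Qed.

Lemma measurable_pos n (B : set (lattice d)) : measurable [set w : W | B (pos w n)].
Proof.
have -> : [set w : W | B (pos w n)] = [set w : W | (B `*` setT) (sval w n)].
  by apply/seteqP; split=> w //= -[].
by apply: measurable_sval; exact: measurableX.
Qed.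

Lemma measurable_wgt n : measurable_fun setT (fun w : W => wgt w n).
Proof.
move=> _ B mB; rewrite setTI.
have -> : (fun w : W => wgt w n) @^-1` B = [set w : W | (setT `*` B) (sval w n)].
  by apply/seteqP; split=> w //= -[].
by apply: measurable_sval; exact: measurableX.
Qed.

Lemma measurable_fun_pos n (f : lattice d -> R) :
  measurable_fun setT (fun w : W => f (pos w n)).
Proof.
move=> _ B mB; rewrite setTI.
by have -> : (fun w : W => f (pos w n)) @^-1` B = [set w : W | (f @^-1` B) (pos w n)] by [];
  exact: measurable_pos.
Qed.

Lemma measurable_local_time x : measurable_fun setT (local_time x).
Proof.
have -> : local_time x = (fun w =>
   \sum_(0 <= n <oo) (wgt w n%:Z * (pos w n%:Z == x)%:R)%:E +
   \sum_(0 <= n <oo) (wgt w (Negz n) * (pos w (Negz n) == x)%:R)%:E)%E.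
  apply/funext => w; rewrite /local_time esum_int// => n.
  by rewrite lee_fin mulr_ge0// ltW// wgt_gt0.
by apply: emeasurable_funD; apply: ge0_emeasurable_sum => n *;
  rewrite ?lee_fin ?mulr_ge0 ?(ltW (wgt_gt0 _ _))//;
  apply/measurable_EFinP; apply: measurable_funM; [exact: measurable_wgt|
  exact: (measurable_fun_pos _ (fun y => (y == x)%:R))|exact: measurable_wgt|
  exact: (measurable_fun_pos _ (fun y => (y == x)%:R))].
Qed.

Definition action V K w : R := \sum_(x <- K) V x * fine (local_time x w).

Lemma measurable_action V K : measurable_fun setT (action V K).
Proof.
apply: (measurable_sum (D := setT)) => x; apply: measurable_funM; first exact: measurable_cst.
by apply: (@measurableT_comp _ _ _ _ _ _ fine) => //; exact: measurable_local_time.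
Qed.

Definition part_action V N w : R := \sum_(n < N) V (pos w n%:Z) * wgt w n%:Z.

Lemma measurable_part_action V N : measurable_fun setT (part_action V N).
Proof.
apply: measurable_sum => n; apply: measurable_funM; last exact: measurable_wgt.
exact: measurable_fun_pos.
Qed.

(** When the backward path avoids [K], negative times contribute nothing to the local times in [K],
    and the forward sums recover the whole action. *)
Lemma cvg_part_action V K w : (forall z, z \notin K -> V z = 0) ->
  backward w \in no_return K ->
  part_action V N w @[N --> \oo] --> action V K w.
Proof.
move=> V0; rewrite inE => bw.
have lt x : x \in K -> \sum_(n < N) wgt w n%:Z * (pos w n%:Z == x)%:R @[N --> \oo] -->
    fine (local_time x w).
  move=> xK.
  have lE : local_time x w = (\sum_(0 <= n <oo) (wgt w n%:Z * (pos w n%:Z == x)%:R)%:E)%E.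
    rewrite /local_time esum_int => [|n]; last by rewrite lee_fin mulr_ge0// ltW// wgt_gt0.
    rewrite [X in (_ + X)%E]eseries0 ?adde0// => n _ _.
    have := bw n.+1 isT; rewrite /backward -NegzE.
    by case: eqP => [->|_]; [rewrite xK|rewrite mulr0].
  have c : (\sum_(0 <= n < N) (wgt w n%:Z * (pos w n%:Z == x)%:R)%:E)%E @[N --> \oo] -->
      (fine (local_time x w))%:E.
    rewrite fineK ?local_time_fin// lE; apply: is_cvg_nneseries => n _ _.
    by rewrite lee_fin mulr_ge0// ltW// wgt_gt0.
  move/fine_cvgP : c => [_]; apply: cvg_trans; apply: near_eq_cvg; apply: nearW => N /=.
  by rewrite sumEFin /= big_mkord.
have -> : part_action V ^~ w = (fun N => \sum_(x <- K) V x *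
    (\sum_(n < N) wgt w n%:Z * (pos w n%:Z == x)%:R)).
  apply/funext => N; under [RHS]eq_bigr do rewrite mulr_sumr.
  rewrite exchange_big; apply: eq_bigr => n _ /=.
  have [pK|pK] := boolP (pos w n%:Z \in K).
    rewrite (big_fsetD1 _ pK)/= eqxx mulr1 big_seq big1 ?addr0// => x.
    by rewrite in_fsetD1 eq_sym => /andP[/negPf -> _]; rewrite !mulr0.
  rewrite V0// mul0r big_seq big1// => x xK; case: eqP => [e|]; last by rewrite !mulr0.
  by rewrite e xK in pK.
apply: cvg_sum_seq => x xK; apply: cvgM; first exact: cvg_cst.
exact: lt.
Qed.

End local_time.

(** * Laplace functional under the local intensity *)

(** [exp(- v s)] times the exponential density of rate 1 is [1 / (1 + v)] times the density of rate
    [1 + v]. *)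
Lemma integral_exponential_expR (R : realType) (v : R) : -1 < v ->
  (\int[exponential_prob 1]_s (expR (- (v * s)))%:E = ((1 + v)^-1)%:E)%E.
Proof.
move=> v1; have v0 : 0 < 1 + v by lra.
have mf : measurable_fun [set: R] (fun s => expR (- (v * s))).
  apply: (measurableT_comp (@measurable_expR R)).
  under eq_fun do rewrite -mulNr.
  by apply: measurable_funM; [exact: measurable_cst|exact: measurable_id].
have mp (r : R) := @measurable_exponential_pdf R r.
have p0 (r : R) s : 0 <= r -> 0 <= exponential_pdf r s.
  by move=> r0; exact: exponential_pdf_ge0.
rewrite -[LHS]mul1e -(@integral_comp_law _ _ _ _ _ (@lebesgue_measure R) setT measurableT
  (exponential_pdf 1) id (exponential_prob 1) 1) //; last 2 first.
- by move=> s; exact: p0.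
- move=> C mC; rewrite mul1r fineK ?fin_num_measure// /exponential_prob.
  rewrite [RHS]integral_mkcond; apply: eq_integral => s _.
  rewrite patchE indicE; case: ifP => _; by rewrite ?mulr1 ?mulr0.
transitivity (\int[lebesgue_measure]_s (((1 + v)^-1)%:E * (exponential_pdf (1 + v) s)%:E))%E.
  apply: eq_integral => s _; rewrite -EFinM; congr EFin.
  rewrite /exponential_pdf !patchE; case: ifP => _; last by rewrite mul0r mulr0.
  rewrite mul1r mulKf ?gt_eqF// -expRD; congr expR; ring.
rewrite ge0_integralZl_EFin//.
- by rewrite integral_exponential_pdf// mule1.
- by move=> s _; rewrite lee_fin; exact: p0 (ltW v0).
- by apply/measurable_EFinP; exact: mp.
- by rewrite invr_ge0 ltW.
- exact: mp.
Qed.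

Section Qhat.
Variables (R : realType) (d : nat) (d3 : (3 <= d)%N).
Variables (P : lattice d -> probability (walk d) R) (K : {fset lattice d}).
Variable Q : {finite_measure set (What R d3) -> \bar R}.
Hypothesis srwP : srw_laws P.
Hypothesis hQ : is_Qhat P K Q.
Local Notation W := (What R d3).
Implicit Types (x y : lattice d) (V : lattice d -> R).

Let d0 : (0 < d)%N. Proof. exact: leq_trans d3. Qed.

Definition escape x : R := fine (P x (no_return K)).

Let at0 x : set W := [set w | pos w 0 = x].

Let mat0 x : measurable (at0 x).
Proof. exact: (@measurable_pos R d d3 0 [set x]). Qed.

Lemma Qhat_at0 x : Q (at0 x) = ((x \in K)%:R * escape x)%:E.
Proof.
have [-> _] := hQ; rewrite /equilibrium mulrC EFinM fineK//.
by apply: fin_num_measure; exact: measurable_no_return.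
Qed.

(** The measure is described only given the position at time 0, and the lattice is countable. *)
Lemma Qhat_null (E : set W) : measurable E -> (forall x, Q (E `&` at0 x) = 0%E) ->
  Q E = 0%E.
Proof.
move=> mE E0.
have EE : E = \bigcup_n (if choice.unpickle n is Some x then E `&` at0 x else set0).
  apply/seteqP; split=> [w Ew|w [n _]]; last by case: (choice.unpickle n) => // x [].
  by exists (choice.pickle (pos w 0)) => //; rewrite choice.pickleK.
apply/(measure_negligible mE); rewrite EE; apply: negligible_bigcup => n.
case: (choice.unpickle n) => [x|]; last exact: negligible_set0.
by apply/negligibleP; [exact: measurableI|exact: E0].
Qed.

Lemma Qhat_outside : Q (\bigcup_(x in [set x | x \notin K]) at0 x) = 0%E.
Proof.
have mout : measurable (\bigcup_(x in [set x | x \notin K]) at0 x).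
  have -> : \bigcup_(x in [set x | x \notin K]) at0 x =
      [set w : W | [set x | x \notin K] (pos w 0)].
    by apply/seteqP; split=> [w [x xK /= ->]//|w wK]; exists (pos w 0).
  exact: measurable_pos.
apply: Qhat_null => // x.
have [xK|xK] := boolP (x \in K).
  rewrite (_ : _ `&` _ = set0) ?measure0//; apply/seteqP; split=> // w [[y yK /= e] /= e'].
  by move: yK; rewrite /= -e e' xK.
have Qx : Q (at0 x) = 0%E by rewrite Qhat_at0 (negPf xK) mul0r.
by apply: (subset_measure0 _ _ _ Qx) => //; exact: measurableI.
Qed.

Definition good : set W := [set w | no_return K (backward w)].

Lemma measurable_backward (A : set (walk d)) :
  measurable A -> measurable [set w : W | A (backward w)].
Proof.
move=> mA; suff : measurable_fun setT (backward : W -> walk d).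
  by move=> /(_ measurableT _ mA); rewrite setTI.
apply: (@measurability _ _ W (walk d) setT (backward : W -> walk d)
  (@coordinate_events _ (lattice d) nat)); first by rewrite /measurable.
move=> _ [_ [n [B [mB ->]]] <-]; rewrite setTI.
exact: (@measurable_pos R d d3 (- n%:Z) B).
Qed.

Lemma measurable_good : measurable good.
Proof. by apply: measurable_backward; exact: measurable_no_return. Qed.

Lemma Qhat_good : Q (~` good) = 0%E.
Proof.
apply: Qhat_null => [|x]; first by apply: measurableC; exact: measurable_good.
have mI : measurable (~` good `&` at0 x).
  by apply: measurableI => //; apply: measurableC; exact: measurable_good.
have e0 : (0 <= Q (at0 x))%E by [].
have Qfin (A : set W) : measurable A -> Q A \is a fin_num by move=> mA; exact: fin_num_measure.
move: e0; rewrite le_eqVlt => /predU1P[e0|e0].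
  by apply: (subset_measure0 mI (mat0 x) _ (esym e0)) => w [].
have [h1 h2] := hQ; rewrite h1 in e0; have [_ _ hb _ _] := h2 _ e0.
have := hb (~` no_return K) (measurableC (@measurable_no_return d K)).
rewrite /cprob setICl measure0 mul0r => /eqP.
rewrite mulf_eq0 invr_eq0 (fine_eq0 (Qfin _ mI)) (fine_eq0 (Qfin _ (mat0 x))).
by move=> /orP[/eqP//|]; rewrite h1 gt_eqF.
Qed.

Section laplace_path.
Variable V : lattice d -> R.
Hypothesis V1 : forall z, -1 < V z.
Variable x : lattice d.
Let e : R := (x \in K)%:R * escape x.
Hypothesis e0 : 0 < e.
Variable N : nat.
Let a z : R := (1 + V z)^-1.

Let law : Qhat_conditional_law P K x (cprob Q (at0 x)).
Proof. by have [h1 h2] := hQ; apply: h2; rewrite -h1 Qhat_at0 lte_fin. Qed.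

Let cylW n p : set W := [set w | cyl n p (forward w)].

Let mcylW n p : measurable (cylW n p).
Proof.
have -> : cylW n p = \bigcap_(k in [set k | (k <= n)%N]) [set w : W | [set p k] (pos w k%:Z)].
  by apply/seteqP; split=> w h k kn; exact: h.
apply: bigcap_measurable; first by exists 0%N.
by move=> k _; exact: measurable_pos.
Qed.

Let weight (w : W) : R := \prod_(k < N) expR (- (V (pos w k%:Z) * wgt w k%:Z)).

Let mweight : measurable_fun setT weight.
Proof.
apply: measurable_prod => k _; apply: (measurableT_comp (@measurable_expR R)).
under eq_fun do rewrite -mulNr.
apply: measurable_funM; last exact: measurable_wgt.
exact: (measurable_fun_pos _ (fun z => - V z)).
Qed.

Let weight_ge0 w : 0 <= weight w.
Proof. by apply: prodr_ge0 => k _; exact: expR_ge0. Qed.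

(** The conditional law multiplied by the mass [e] of its conditioning event becomes a statement
    about [Q] itself; the backward component is tested on the whole space. *)
Let indep p (C : 'I_N -> set R) : p 0%N = x -> (forall j, measurable (C j)) ->
  Q (cylW N p `&` [set w | forall j : 'I_N, C j (wgt w j%:Z)]) =
  (e * fine (P x (cyl N p)) * \prod_j fine (exponential_prob 1 (C j)))%:E.
Proof.
move=> p0 mC; have [lind lfwd _ lwgt lexp] := law.
pose C' (n : int) : set R :=
  if n is Posz k then if insub k is Some j then C j else setT else setT.
have mC' n : measurable (C' n).
  by case: n => [k|k] //=; case: insubP => [j|].
pose s := [seq Posz k | k <- iota 0 N].
have us : uniq s by rewrite map_inj_uniq ?iota_uniq// => i j [].
have sE : [set w : W | forall n, n \in s -> C' n (wgt w n)] =
    [set w | forall j : 'I_N, C j (wgt w j%:Z)].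
  apply/seteqP; split=> w h.
    move=> j; have := h j%:Z; rewrite /C' valK; apply.
    by rewrite mem_map ?mem_iota//= => i k [].
  move=> n /mapP[k]; rewrite mem_iota add0n => /andP[_ kN] -> /=.
  by rewrite insubT; exact: h.
have := lwgt s C' us mC'.
rewrite sE.
pose CC : set (weights R) := [set g | forall j : 'I_N, C j (g j%:Z)].
have mCC : measurable CC.
  have -> : CC = \bigcap_(j in [set: 'I_N]) [set g : weights R | C j (g j%:Z)].
    by apply/seteqP; split=> g h j; [move=> _|]; exact: h.
  apply: fin_bigcap_measurable => // j _.
  by apply: sub_sigma_algebra; exists j%:Z, (C j).
have -> : [set w : W | forall j : 'I_N, C j (wgt w j%:Z)] = holding @^-1` CC by [].
have lT : cprob Q (at0 x) (backward @^-1` setT) = 1.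
  by rewrite /cprob preimage_setT setTI divff// Qhat_at0/= gt_eqF.
have := lind (cyl N p) setT CC (measurable_cyl N p) measurableT mCC.
rewrite lT mulr1 lfwd; last exact: measurable_cyl.
rewrite preimage_setT setIT => h1 h2; move: h1; rewrite h2 {h2}.
rewrite /cprob.
have sub : forward @^-1` cyl N p `&` holding @^-1` CC `&` at0 x =
    cylW N p `&` holding @^-1` CC.
  apply/seteqP; split=> w; first by case.
  by move=> [h1 h2]; split=> //; rewrite /at0 /= -p0; exact: (h1 0%N).
rewrite sub Qhat_at0 -/e /= => h.
have mI : measurable (cylW N p `&` holding @^-1` CC).
  have -> : holding @^-1` CC = \bigcap_(j in [set: 'I_N]) [set w : W | C j (wgt w j%:Z)].
    by apply/seteqP; split=> g hh j; [move=> _|]; exact: hh.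
  apply: measurableI => //; apply: fin_bigcap_measurable => // j _.
  by rewrite -[X in measurable X]setTI; exact: measurable_wgt.
rewrite -[LHS]fineK; last exact: fin_num_measure.
congr EFin; move/(congr1 (fun r => r * e)): h; rewrite divfK ?gt_eqF// => ->.
rewrite mulrC mulrA; congr (_ * _).
have iE : iota 0 N = index_iota 0 N by rewrite /index_iota subn0.
rewrite /s big_map iE big_mkord.
by apply: eq_bigr => j _; rewrite -(lexp j%:Z _ (mC j)) /C' valK /cprob Qhat_at0.
Qed.

Let path_integral_end p : p 0%N = x ->
  (\int[Q]_(w in cylW N p) (weight w)%:E =
   (e * fine (P x (cyl N p)) * \prod_(k < N) a (p k))%:E)%E.
Proof.
move=> p0.
transitivity (\int[Q]_(w in cylW N p)
    (\prod_(j < N) (fun s => expR (- (V (p j) * s))) (wgt w j%:Z))%:E)%E.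
  apply: eq_integral => w; rewrite inE => cw; congr EFin.
  apply: eq_bigr => k _; have := cw k (ltnW (ltn_ord k)); rewrite /forward => -> //.
have HH := (@integral_prod_indep _ _ W (measurableTypeR R) R Q (cylW N p) (mcylW N p) N
  (fun j w => wgt w j%:Z) (fun=> exponential_prob 1) (e * fine (P x (cyl N p)))
  (fun j => @measurable_wgt R d d3 j%:Z) (fun C mC => indep p0 mC)
  (fun j s => expR (- (V (p j) * s))) (fun j => a (p j))); apply: HH => [j|j s|j].
- apply: (measurableT_comp (@measurable_expR R)).
  under eq_fun do rewrite -mulNr.
  by apply: measurable_funM; [exact: measurable_cst|exact: measurable_id].
- exact: expR_ge0.
- exact: integral_exponential_expR.
Qed.

(** Induction on the number [m] of free steps. For [m = 0] all positions in [weight] are fixed and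
    only independent exponentials remain; summing over the next position reproduces the recursion of
    [fk]. *)
Let path_integral m n p : p 0%N = x -> (n + m = N)%N ->
  (\int[Q]_(w in cylW n p) (weight w)%:E =
   (e * fine (P x (cyl n p)) * \prod_(k < n) a (p k) * fk a m (p n))%:E)%E.
Proof.
elim: m n p => [|m ih] n p p0 nmN.
  by rewrite addn0 in nmN; rewrite nmN path_integral_end// mulr1.
(* Elements of [What] are nearest-neighbour by definition, so the cylinder is exactly the union of
   its extensions, with no null set left over. *)
have cE : cylW n p = \big[setU/set0]_(s <- steps d) cylW n.+1 (extend n p (p n + s)).
  rewrite -(@bigcup_seq _ _ (steps d) (fun s => cylW n.+1 (extend n p (p n + s)))).
  apply/seteqP; split=> w.
    move=> cw; have [_ adj _ _ _] := svalP w.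
    have := adj n%:Z; rewrite adjacentE => sS.
    exists (pos w (n.+1)%:Z - pos w n%:Z).
      by move: sS; rewrite /pos -PoszD addn1.
    rewrite /cylW /= cyl_extend; split=> //=.
    by rewrite -(cw n (leqnn n)) /forward addrC subrK.
  by move=> [s _]; rewrite /cylW /= cyl_extend => -[].
rewrite cE ge0_integral_bigsetU//; first last.
- by move=> w _; rewrite lee_fin.
- by apply/measurable_EFinP; exact: measurable_funTS.
- move=> s t _ _ [w []]; rewrite /cylW /= !cyl_extend => -[_ /= e1] [_ /= e2].
  by apply: (addrI (p n)); rewrite -e1 -e2.
- exact: uniq_steps.
transitivity (\sum_(s <- steps d) (e * (fine (P x (cyl n p)) / (2 * d)%:R) *
    (\prod_(k < n.+1) a (p k)) * fk a m (p n + s))%:E)%E.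
  apply: eq_big_seq => s sS; rewrite ih//; last by rewrite addSnnS.
  rewrite (srw_cylS srwP) fineM ?fin_num_measure//; last exact: measurable_cyl.
  have -> : extend n p (p n + s) n.+1 = p n + s by rewrite /extend ltnn.
  rewrite /= addrAC subrr add0r sS mul1r; congr (_ * _ * _)%:E.
  by apply: eq_bigr => k _; rewrite /extend -ltnS ltn_ord.
rewrite sumEFin -mulr_sumr; congr EFin.
rewrite big_ord_recr/= /avg; ring.
Qed.

Lemma path_laplace :
  (\int[Q]_(w in at0 x) (expR (- part_action V N w))%:E = (e * fk a N x)%:E)%E.
Proof.
have := @path_integral N 0 (fun=> x) erefl (add0n _).
rewrite (srw_cyl0 srwP) eqxx mulr1 big_ord0 mulr1.
have -> : cylW 0 (fun=> x) = at0 x.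
  by apply/seteqP; split=> w /=; [exact|move=> h [|]//].
move=> <-; apply: eq_integral => w _; congr EFin.
by rewrite /weight -expR_sum /part_action sumrN.
Qed.

End laplace_path.

Lemma Qhat_laplace_part V N : (forall z, -1 < V z) ->
  (\int[Q]_w (expR (- part_action V N w))%:E =
   (\sum_(x <- K) escape x * fk (fun z => (1 + V z)^-1) N x)%:E)%E.
Proof.
move=> V1; set F := fun w => (expR (- part_action V N w))%:E.
have mF : measurable_fun setT F.
  apply/measurable_EFinP; apply: (measurableT_comp (@measurable_expR R)).
  under eq_fun do rewrite -mulN1r.
  by apply: measurable_funM; [exact: measurable_cst|exact: measurable_part_action].
have mD : measurable (\big[setU/set0]_(x <- K) at0 x) by apply: bigsetU_measurable.
rewrite (@ge0_integral_conegligible _ _ _ _ (\big[setU/set0]_(x <- K) at0 x))//; last first.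
  have <- := Qhat_outside; congr (Q _).
  rewrite -(@bigcup_seq _ _ (K : seq _) at0); apply/seteqP; split=> w /=.
    by move=> h; exists (pos w 0) => //; apply/negP => wK; apply: h; exists (pos w 0).
  by move=> [x xK /= e] [y yK /= e']; move: xK; rewrite /= -e e' yK.
rewrite ge0_integral_bigsetU//; first last.
- exact: measurable_funTS.
- by move=> x y _ _ [w [/= <- <-]].
rewrite -sumEFin; apply: eq_big_seq => x xK.
have e0 : 0 <= escape x by apply: fine_ge0.
(* If [escape x] is 0 no conditional law is available, but then the event of starting at [x] is
   null. *)
move: e0; rewrite le_eqVlt => /predU1P[e0|e0].
  transitivity (\int[Q]_(w in at0 x) `|F w|)%E.
    by apply: eq_integral => w _; rewrite gee0_abs// lee_fin expR_ge0.
  rewrite -e0 mul0r; apply: integral_abs_eq0 => //; first exact: measurable_funTS.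
  by apply: eq_trans (Qhat_at0 x) _; rewrite -e0 mulr0.
by rewrite path_laplace// ?xK ?mul1r.
Qed.

End Qhat.

Section Qhat_limit.
Variables (R : realType) (d : nat) (d3 : (3 <= d)%N).
Variables (P : lattice d -> probability (walk d) R) (K : {fset lattice d}).
Variable Q : {finite_measure set (What R d3) -> \bar R}.
Hypothesis srwP : srw_laws P.
Hypothesis hQ : is_Qhat P K Q.
Implicit Types (V U phi : lattice d -> R).

Let measurable_exp_opp (f : What R d3 -> R) : measurable_fun setT f ->
  measurable_fun setT (fun w => (expR (- f w))%:E).
Proof.
move=> mf; apply/measurable_EFinP; apply: (measurableT_comp (@measurable_expR R)).
under eq_fun do rewrite -mulN1r.
by apply: measurable_funM => //; exact: measurable_cst.
Qed.

Let cvg_exp_opp (u : nat -> R) (l : R) : u n @[n --> \oo] --> l ->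
  (expR (- u n))%:E @[n --> \oo] --> (expR (- l))%:E.
Proof.
move=> ul; apply: cvg_EFin; first exact: nearW.
by apply: continuous_cvg; [exact: continuous_expR|exact: cvgN].
Qed.

(** Dominated convergence along the partial actions. The majorant is the exponential of the action
    of [U]: it dominates since [- U <= V], and it is integrable by monotone convergence and the
    uniform bound on [fk]. *)
Lemma Qhat_laplace V U phi :
    (forall z, z \notin K -> V z = 0) -> (forall z, z \notin K -> U z = 0) ->
    (forall z, -1 < V z) -> (forall z, 0 <= U z < 1) -> (forall z, - U z <= V z) ->
    (forall x, exists B, forall n, fk (fun z => (1 - U z)^-1) n x <= B) ->
    (forall x, fk (fun z => (1 + V z)^-1) n x @[n --> \oo] --> phi x) ->
  (\int[Q]_w (expR (- action V K w))%:E =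
   (\sum_(x <- K) escape P K x * phi x)%:E)%E.
Proof.
move=> VK UK V1 U01 UV bnd cphi.
have mG := @measurable_good R d d3 K; have G0 := Qhat_good hQ.
pose V' z := - U z.
have VK' z : z \notin K -> V' z = 0 by move=> /UK; rewrite /V' => ->; rewrite oppr0.
have V1' z : -1 < V' z by rewrite ltrN2; have /andP[] := U01 z.
have cpart (f : lattice d -> R) w : (forall z, z \notin K -> f z = 0) -> good K w ->
    (expR (- part_action f N w))%:E @[N --> \oo] --> (expR (- action f K w))%:E.
  by move=> fK gw; apply: cvg_exp_opp; apply: cvg_part_action => //; rewrite inE.
have nd w : nondecreasing_seq (fun N => - part_action V' N w).
  apply/nondecreasing_seqP => N; rewrite /part_action big_ord_recr/= opprD lerDl.
  by rewrite /V' mulNr opprK mulr_ge0 ?(ltW (wgt_gt0 _ _))//; have /andP[] := U01 (pos w N%:Z).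
have bound : (\int[Q]_(w in good K) (expR (- action V' K w))%:E < +oo)%E.
  have /choice[B hB] := bnd.
  apply: (@le_lt_trans _ _ (\sum_(x <- K) escape P K x * B x)%:E); last exact: ltry.
  have cl : (\int[Q]_(w in good K) (expR (- part_action V' N w))%:E @[N --> \oo] -->
      \int[Q]_(w in good K) (expR (- action V' K w))%:E)%E.
    have -> : (\int[Q]_(w in good K) (expR (- action V' K w))%:E =
        \int[Q]_(w in good K) limn (fun N => (expR (- part_action V' N w))%:E))%E.
      by apply: eq_integral => w; rewrite inE => gw; apply/esym/cvg_lim => //; exact: cpart.
    apply: cvg_monotone_convergence => //.
    - by move=> N; apply: measurable_funTS; apply: measurable_exp_opp;
      exact: measurable_part_action.
    - by move=> w _ m n mn; rewrite lee_fin ler_expR; exact: nd.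
  rewrite -(cvg_lim _ cl)//; apply: lime_le; first by apply/cvg_ex; eexists; exact: cl.
  apply: nearW => N; rewrite -(ge0_integral_conegligible mG G0) => [|w]; last first.
    by rewrite lee_fin expR_ge0.
  rewrite (Qhat_laplace_part srwP hQ)// lee_fin; apply: ler_sum => x _.
  by rewrite ler_wpM2l ?fine_ge0//; exact: hB.
rewrite (ge0_integral_conegligible mG G0) => [|w]; last first.
  by rewrite lee_fin expR_ge0.
have m1 N : measurable_fun (good K) (fun w : What R d3 => (expR (- part_action V N w))%:E).
  by apply: measurable_funTS; apply: measurable_exp_opp;
      exact: measurable_part_action.
have m2 f : measurable_fun (good K) (fun w : What R d3 => (expR (- action f K w))%:E).
  by apply: measurable_funTS; apply: measurable_exp_opp; exact: measurable_action.
have ig : Q.-integrable (good K) (fun w : What R d3 => (expR (- action V' K w))%:E).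
  apply/integrableP; split; first exact: m2.
  apply: le_lt_trans bound; rewrite le_eqVlt; apply/orP; left; apply/eqP.
  by apply: eq_integral => w _; rewrite gee0_abs// lee_fin expR_ge0.
have dom : {ae Q, forall (w : What R d3) N, good K w ->
    (`|(expR (- part_action V N w))%:E| <= (expR (- action V' K w))%:E)%E}.
  apply: aeW => w N gw; rewrite gee0_abs ?lee_fin ?expR_ge0// ler_expR.
  apply: (@le_trans _ _ (- part_action V' N w)).
    rewrite lerN2; apply: ler_sum => k _.
    by apply: ler_wpM2r; [exact: ltW (wgt_gt0 _ _)|exact: UV].
  have c : (fun N => - part_action V' N w) @ \oo --> - action V' K w.
    by apply: cvgN; apply: cvg_part_action => //; rewrite inE.
  rewrite -(cvg_lim _ c)//; apply: nondecreasing_cvgn_le; first exact: nd.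
  by apply/cvg_ex; eexists; exact: c.
have [_ _ cd] := dominated_convergence mG m1 (m2 V)
  (aeW _ (fun w => cpart _ V w VK)) ig dom.
have cr : (\int[Q]_(w in good K) (expR (- part_action V N w))%:E @[N --> \oo] -->
    (\sum_(x <- K) escape P K x * phi x)%:E)%E.
  under eq_fun => N.
    rewrite -(ge0_integral_conegligible mG G0) => [|w]; last by rewrite lee_fin expR_ge0.
    rewrite (Qhat_laplace_part srwP hQ)//.
    over.
  apply: cvg_EFin; first exact: nearW.
  by apply: cvg_sum_seq => x _; apply: cvgM => //; exact: cvg_cst.
by rewrite -(cvg_lim _ cd)// (cvg_lim _ cr).
Qed.

End Qhat_limit.

(** * Trajectories modulo time shift *)

Section quotient.
Variables (R : realType) (d : nat) (d3 : (3 <= d)%N).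
Local Notation W := (What R d3).
Local Notation WS := (Wstar R d3).
Implicit Types (w : W) (x : lattice d) (K : {fset lattice d}) (V : lattice d -> R).

Lemma repr_pistar w : shift_equiv (repr (pistar w)) w.
Proof.
have /eqmodP // : (\pi_WS (repr (pistar w)) = \pi_WS w)%qT.
by rewrite reprK.
Qed.

Lemma local_time_shift x w w' : shift_equiv w w' -> local_time x w = local_time x w'.
Proof.
move=> /asboolP[k h]; rewrite /local_time.
rewrite [RHS](@reindex_esum _ _ _ setT setT (fun n : int => n + k)).
  by apply: eq_esum => n _; rewrite /wgt /pos h.
split=> //; first by move=> m n _ _ /addIr.
by move=> n _; exists (n - k) => //; rewrite subrK.
Qed.

Lemma hitting_shift K w w' : shift_equiv w w' -> hitting K w -> hitting K w'.
Proof. by move=> /asboolP[k h] [n wn]; exists (n + k); rewrite /pos -h. Qed.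

Lemma preimage_pistar_hitting K : pistar @^-1` (pistar @` hitting K) = (hitting K : set W).
Proof.
apply/seteqP; split=> [w [w' hw' e]|w hw]; last by exists w.
apply: hitting_shift hw'; have /eqmodP := e; exact.
Qed.

Lemma measurable_hitting K : measurable (hitting K : set W).
Proof.
have -> : (hitting K : set W) =
    (\bigcup_(n : nat) [set w : W | [set x | x \in K] (pos w n%:Z)]) `|`
    (\bigcup_(n : nat) [set w : W | [set x | x \in K] (pos w (Negz n))]).
  apply/seteqP; split=> w; first by move=> [[n|n] wn]; [left|right]; exists n.
  by case=> -[n _ wn]; [exists n%:Z|exists (Negz n)].
by apply: measurableU; apply: bigcupT_measurable => n; exact: measurable_pos.
Qed.

Lemma measurable_pistar_hitting K : measurable (pistar @` hitting K : set WS).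
Proof.
rewrite /measurable /= /Wstar_measurable /=.
by rewrite preimage_pistar_hitting; exact: measurable_hitting.
Qed.

Lemma measurable_fun_pistar : measurable_fun setT (pistar : W -> WS).
Proof. by move=> _ A mA; rewrite setTI. Qed.

(** Local times are invariant under time shift, so the chosen representative is immaterial and
    measurability can be tested after composing with [pistar]. *)
Definition weight_star V K (p : WS) : R := expR (- action V K (repr p)).

Lemma weight_star_pistar V K w : weight_star V K (pistar w) = expR (- action V K w).
Proof.
congr (expR (- _)); apply: eq_bigr => x _.
by rewrite (local_time_shift _ (repr_pistar w)).
Qed.

Lemma measurable_weight_star V K : measurable_fun setT (weight_star V K).
Proof.
move=> _ B mB; rewrite setTI.
have mf : measurable_fun setT (fun w : W => expR (- action V K w)).
  apply: (measurableT_comp (@measurable_expR R)).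
  under eq_fun do rewrite -mulN1r.
  by apply: measurable_funM; [exact: measurable_cst|exact: measurable_action].
have := mf measurableT B mB; rewrite setTI.
suff -> : (fun w : W => expR (- action V K w)) @^-1` B =
    pistar @^-1` (weight_star V K @^-1` B) by [].
by apply/seteqP; split=> w /=; rewrite weight_star_pistar.
Qed.

End quotient.

Section nuhat.
Variables (R : realType) (d : nat) (d3 : (3 <= d)%N).
Variable Q : {fset lattice d} -> {finite_measure set (What R d3) -> \bar R}.
Variable nu : {sigma_finite_measure set (Wstar R d3) -> \bar R}.
Hypothesis hnu : is_nuhat Q nu.
Implicit Types (K : {fset lattice d}) (V : lattice d -> R).

Lemma nuhat_hitting K : nu (pistar @` hitting K) = Q K setT.
Proof. by have := hnu K measurableT; rewrite setTI preimage_setT. Qed.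

(** On sets of trajectories hitting [K], [nu] is the image of [Q K] under [pistar]; the same
    relation, applied to the complement, shows that [Q K] charges only [hitting K]. *)
Lemma integral_nuhat K V :
  (\int[nu]_(p in pistar @` hitting K) (weight_star V K p)%:E =
   \int[Q K]_w (expR (- action V K w))%:E)%E.
Proof.
have mH := @measurable_pistar_hitting R d d3 K.
have mp := @measurable_fun_pistar R d d3.
transitivity (\int[Q K]_(w in pistar @^-1` (pistar @` hitting K))
    ((fun p => (weight_star V K p)%:E) \o pistar) w)%E.
  rewrite -(ge0_integral_pushforward mp)//; first last.
  - by move=> p _; rewrite lee_fin expR_ge0.
  - by apply/measurable_EFinP; apply: measurable_funTS; exact: measurable_weight_star.
  apply: eq_measure_integral => A mA AH; apply: eq_trans (hnu K mA); congr (nu _).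
  by apply/esym/setIidPl.
rewrite preimage_pistar_hitting [RHS](@ge0_integral_conegligible _ _ _ _ (hitting K)).
- by apply: eq_integral => w _ /=; rewrite weight_star_pistar.
- exact: measurable_hitting.
- rewrite -preimage_pistar_hitting preimage_setC.
  by apply: eq_trans (esym (hnu K (measurableC mH))) _; rewrite setICl measure0.
- by move=> w; rewrite lee_fin expR_ge0.
Qed.

End nuhat.

(** * Transience from the existence of the process *)

Section transience.
Variables (R : realType) (d : nat) (d3 : (3 <= d)%N).
Context (dO : measure_display) (Omega : measurableType dO).
Variable pts : Omega -> nat -> Wstar R d3 * R.
Variable P : lattice d -> probability (walk d) R.
Variable Q : {fset lattice d} -> {finite_measure set (What R d3) -> \bar R}.
Variable nu : {sigma_finite_measure set (Wstar R d3) -> \bar R}.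
Variable Pr : probability Omega R.
Hypothesis ri : random_interlacements pts P Q nu Pr.

Let d0 : (0 < d)%N. Proof. exact: leq_trans d3. Qed.

Lemma intensityE (B : set (Wstar R d3)) (I : set R) :
  measurable B -> measurable I -> I `<=` [set t | 0 <= t] ->
  intensity nu (B `*` I) = (nu B * lebesgue_measure I)%E.
Proof.
move=> mB mI I0; rewrite /intensity -product_measure1E//; congr (_ _).
by apply/setIidPl => -[p t] [_ /= /I0].
Qed.

(** [pts] lists one point for each natural number, all at nonnegative levels, so the total count is
    never 0; with zero intensity it would be 0 almost surely. *)
Lemma nuhat_neq0 : nu setT != 0%E.
Proof.
have [_ _ _ t0 [mN hN _ _]] := ri; apply/eqP => nu0.
have mR : measurable [set t : R | 0 <= t].
  by rewrite -[X in measurable X](_ : `[0, +oo[%classic = _)//;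
    apply/seteqP; split=> t /=; rewrite in_itv/= andbT.
pose A : set (Wstar R d3 * R) := setT `*` [set t : R | 0 <= t].
have mA : measurable A by exact: measurableX.
have iA : intensity nu A = 0%E by rewrite intensityE// nu0 mul0e.
have := hN A 0%N mA; rewrite iA ltry => /(_ isT).
rewrite /poisson_prob ltxx diracE mem_set//.
rewrite (_ : [set w | _] = set0) ?measure0; first by move=> /eqP; rewrite eq_sym onee_eq0.
apply/seteqP; split=> // w /=; rewrite /point_count nneseries_recl// diracE mem_set//=.
  move=> /eqP; apply/negP; rewrite gt_eqF//; apply: (@lt_le_trans _ _ 1%E) => //.
  by rewrite leeDl// nneseries_ge0.
by split=> //=; exact: t0.
Qed.

(** Otherwise every [Q K] vanishes, hence so does [nu] on the trajectories through any given site,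
    and countably many such sets cover [Wstar]. *)
Lemma escape_pos : exists K : {fset lattice d}, exists2 x, x \in K & 0 < escape P K x.
Proof.
have [srwP hQ hnu _ _] := ri.
apply/not_existsP => h; case/eqP: nuhat_neq0.
have nuK (K : {fset lattice d}) : nu (pistar @` hitting K) = 0%E.
  rewrite (nuhat_hitting hnu); apply: (Qhat_null (Q := Q K)) => // x.
  rewrite setTI (Qhat_at0 (hQ K)).
  have [xK|] := boolP (x \in K); last by rewrite mul0r.
  suff -> : escape P K x = 0 by rewrite mulr0.
  apply/eqP; rewrite eq_le fine_ge0// andbT leNgt; apply/negP => e0.
  by apply: (h K); exists x.
have cover : [set: Wstar R d3] = \bigcup_n (if choice.unpickle n is Some x then
    pistar @` hitting [fset (x : lattice d)]%fset else set0).
  apply/seteqP; split=> // p _.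
  exists (choice.pickle (pos (repr p) 0)) => //; rewrite choice.pickleK.
  exists (repr p); last exact: reprK.
  by exists 0; rewrite in_fset1.
apply/(measure_negligible measurableT); rewrite cover; apply: negligible_bigcup => n.
case: (choice.unpickle n) => [x|]; last exact: negligible_set0.
by apply/negligibleP; [exact: measurable_pistar_hitting|exact: nuK].
Qed.

(** Never returning to [K] entails never returning to its point [x], so [x] alone has a positive
    escape probability. *)
Lemma ri_transient : transient R d.
Proof.
have [srwP _ _ _ _] := ri; have [K [x xK e0]] := escape_pos.
apply: (escape_transient d0 e0 (y := x)) => n.
have mn := @measurable_no_return d K.
rewrite -lee_fin -(srw_escape d0 srwP) /escape fineK ?fin_num_measure//.
apply: le_measure; rewrite ?inE//.
  exact: measurable_no_return_upto.
move=> X h j /andP[j1 _]; rewrite in_fset1; apply/eqP => Xj.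
by have := h j j1; rewrite Xj xK.
Qed.

End transience.

(** * Laplace transform of the occupation times *)

Section laplace.
Variables (R : realType) (d : nat) (d3 : (3 <= d)%N).
Context (dO : measure_display) (Omega : measurableType dO).
Variable pts : Omega -> nat -> Wstar R d3 * R.
Variable P : lattice d -> probability (walk d) R.
Variable Q : {fset lattice d} -> {finite_measure set (What R d3) -> \bar R}.
Variable nu : {sigma_finite_measure set (Wstar R d3) -> \bar R}.
Variable Pr : probability Omega R.
Hypothesis ri : random_interlacements pts P Q nu Pr.
Variables (K : {fset lattice d}) (V : lattice d -> R) (u : R).
Hypothesis VK : forall x, x \notin K -> V x = 0.
Hypothesis u0 : 0 <= u.

Let d0 : (0 < d)%N. Proof. exact: leq_trans d3. Qed.
Let H : set (Wstar R d3) := pistar @` hitting K.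
Let I : set R := [set` `[0, u]].

Lemma occupation_time_bounded x w M : x \in K ->
    (forall i, (M <= i)%N -> ~ (H `*` I) (pts w i)) ->
  occupation_time pts x u w =
  (\sum_(i < M | pts w i \in H `*` I) fine (local_time x (repr (pts w i).1)))%:E.
Proof.
move=> xK hM; have [_ _ _ t0 _] := ri.
have outside i : ~ (H `*` I) (pts w i) ->
    (\esum_(n in [set: int]) (wgt (repr (pts w i).1) n *
      ((pos (repr (pts w i).1) n == x) && ((pts w i).2 <= u))%:R)%:E = 0)%E.
  move=> hi; apply: esum1 => n _; case: eqP => [e|_]; last by rewrite mulr0.
  case: leP => [tu|_]; last by rewrite mulr0.
  case: hi; split=> /=; last by rewrite /I/= in_itv/= t0.
  by exists (repr (pts w i).1); [exists n; rewrite e|exact: reprK].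
rewrite /occupation_time (nneseries_split _ M)//=; last first.
  by move=> i _; apply: esum_ge0 => n _; rewrite lee_fin mulr_ge0// ltW// wgt_gt0.
rewrite add0n [X in (_ + X)%E]eseries0 => [|i Mi _]; last by apply: outside; exact: hM.
rewrite adde0 big_mkord [in RHS]big_mkcond -sumEFin; apply: eq_bigr => i _.
case: ifPn => [|]; last by rewrite notin_setE => /outside.
rewrite inE => -[_]; rewrite /I /= in_itv/= => /andP[_ tu].
rewrite fineK ?local_time_fin//; apply: eq_esum => n _.
by rewrite tu andbT.
Qed.

Lemma expeR_action_bounded w M :
    (forall i, (M <= i)%N -> ~ (H `*` I) (pts w i)) ->
  expeR (- (\sum_(x \in [set: lattice d]) (V x)%:E * occupation_time pts x u w))%E =
  (\prod_(i < M | pts w i \in H `*` I) weight_star V K (pts w i).1)%:E.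
Proof.
move=> hM.
have -> : (\sum_(x \in [set: lattice d]) (V x)%:E * occupation_time pts x u w)%E =
    (\sum_(x <- K) (V x)%:E * occupation_time pts x u w)%E.
  rewrite [RHS]fsbig_seq ?fset_uniq//; apply/esym/fsbig_widen => // x [_ /= /negP xK].
  by rewrite VK// mul0e.
rewrite (eq_big_seq (fun x => (\sum_(i < M | pts w i \in H `*` I)
    V x * fine (local_time x (repr (pts w i).1)))%:E)) => [|x xK]; last first.
  by rewrite (occupation_time_bounded xK hM) -EFinM mulr_sumr.
rewrite sumEFin -EFinN /=; congr EFin; rewrite exchange_big /= -sumrN expR_sum.
by apply: eq_bigr => i _.
Qed.

Variables (U phi : lattice d -> R).
Hypothesis UK : forall x, x \notin K -> U x = 0.
Hypothesis V1 : forall x, -1 < V x.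
Hypothesis U01 : forall x, 0 <= U x < 1.
Hypothesis UV : forall x, - U x <= V x.
Hypothesis bnd : forall x, exists B, forall n, fk (fun z => (1 - U z)^-1) n x <= B.
Hypothesis cphi : forall x, fk (fun z => (1 + V z)^-1) n x @[n --> \oo] --> phi x.
Hypothesis ker0 : forall f : lattice d -> R,
  {in K, forall x, f x + \sum_(y <- K) greenR R x y * (V y * f y) = 0} ->
  {in K, forall x, f x = 0}.

Lemma laplace_of_limit : laplace_identity pts P Pr K V u.
Proof.
have [srwP hQ hnu t0 pp] := ri; have tr := ri_transient ri.
have gG : green P = @greenR R d by apply/funext => x; apply/funext => y; exact: green_greenR.
have detE J : green_det P J = kernel_det 0 (@greenR R d) J by rewrite -gG.
have cofE J : green_cof P J = kernel_cof 0 (@greenR R d) J by rewrite -gG.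
have numP : \sum_(J <- fpowerset K) green_cof P J * \prod_(x <- J) V x =
    \sum_(J <- fpowerset K) kernel_cof 0 (@greenR R d) J * \prod_(x <- J) V x.
  by apply: eq_bigr => J _; rewrite cofE.
have denP : \sum_(J <- fpowerset K) green_det P J * \prod_(x <- J) V x =
    \sum_(J <- fpowerset K) kernel_det 0 (@greenR R d) J * \prod_(x <- J) V x.
  by apply: eq_bigr => J _; rewrite detE.
rewrite /laplace_identity numP denP => {numP denP}.
have V1' z : 1 + V z != 0 by rewrite gt_eqF// -ltrBlDl sub0r.
have phiE x : phi x + \sum_(y <- K) greenR R x y * (V y * phi y) = 1.
  exact: (fk_limit_eq d0 tr x VK V1' cphi).
have den0 := det_marked_mx_neq0 (0 : lattice d) (@greenRC R d) ker0.
have numE := cof_sum_solution (0 : lattice d) (@greenRC R d) (fun x _ => phiE x).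
split; first exact: den0.
set esc := escape P K.
(* The action over zero steps is 0, so its Laplace functional is the total mass. *)
have QT : Q K setT = (\sum_(x <- K) esc x)%:E.
  have := Qhat_laplace_part srwP (hQ K) 0 V1.
  under eq_integral do rewrite /part_action big_ord0 oppr0 expR0.
  by rewrite integral_cst// mul1e => ->; congr EFin; apply: eq_bigr => x _; rewrite mulr1.
have mH : measurable H by exact: measurable_pistar_hitting.
have nuH : nu H = (\sum_(x <- K) esc x)%:E by rewrite (nuhat_hitting hnu) QT.
rewrite (@poisson_product _ _ _ _ _ _ _ _ pp nu H mH _ u u0 _ (weight_star V K)
  (\sum_(x <- K) esc x * phi x))//.
- transitivity (expR (u * (\sum_(x <- K) esc x * phi x - \sum_(x <- K) esc x)))%:E.
    by congr (expR (u * (_ - _)))%:E; exact: (congr1 fine nuH).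
  congr (expR _)%:E; rewrite -mulrN; congr (_ * _).
  rewrite numE [X in X / _]mulrC mulfK// -sumrB.
  (* Writing the 1 in the total mass as [phi + G V phi] cancels [phi]. After exchanging the sums,
     symmetry of [G] and [G e_K = 1] on [K] remove the escape probabilities. *)
  transitivity (\sum_(x <- K) \sum_(y <- K) - (esc x * greenR R x y * (V y * phi y))).
    apply: eq_bigr => x _; rewrite -{2}[esc x]mulr1 -(phiE x) mulrDr opprD addrA subrr add0r.
    by rewrite mulr_sumr -sumrN; apply: eq_bigr => y _; rewrite mulrA.
  rewrite exchange_big /= -sumrN !big_seq; apply: eq_bigr => y yK.
  rewrite sumrN; congr (- _); rewrite -mulr_suml -[RHS]mul1r; congr (_ * _).
  rewrite -(sum_greenR_escape d0 tr yK (e := esc)) => [|x _]; last exact: cvg_escape.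
  by apply: eq_bigr => x _; rewrite mulrC greenRC.
- by apply: (@eq_ind_r _ _ (fun z => z < +oo)%E _ _ nuH); rewrite ltry.
- move=> B mB; rewrite intensityE//.
  + rewrite lebesgue_measure_itv/= lte_fin; case: ltgtP u0 => // [u1 _|<- _].
      by rewrite sube0.
    by rewrite mule0.
  + by move=> t /=; rewrite in_itv/= => /andP[].
- exact: measurable_weight_star.
- by move=> p; exact: expR_ge0.
- rewrite (integral_nuhat hnu); exact: (Qhat_laplace srwP (hQ K) VK UK V1 U01 UV bnd cphi).
- by move=> w; exact: expeR_ge0.
- by move=> w M; exact: expeR_action_bounded.
Qed.

End laplace.

(** * Choice of the constant and conclusion in the two cases *)

Unset Implicit Arguments.

Theorem theorem2p3 (R : realType) (d : nat) (d3 : (3 <= d)%N)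
    (K : {fset lattice d}) :
  (exists2 c : R, 0 < c &
    forall (P : lattice d -> probability (walk d) R)
      (Q : {fset lattice d} -> {finite_measure set (What R d3) -> \bar R})
      (nu : {sigma_finite_measure set (Wstar R d3) -> \bar R})
      (dO : measure_display) (Omega : measurableType dO)
      (Pr : probability Omega R) (pts : Omega -> nat -> Wstar R d3 * R)
      (V : lattice d -> R) (u : R),
    random_interlacements pts P Q nu Pr ->
    (forall x, x \notin K -> V x = 0) ->
    (forall x, `|V x| <= c) ->
    0 <= u ->
    laplace_identity pts P Pr K V u) /\
  (forall (P : lattice d -> probability (walk d) R)
      (Q : {fset lattice d} -> {finite_measure set (What R d3) -> \bar R})
      (nu : {sigma_finite_measure set (Wstar R d3) -> \bar R})
      (dO : measure_display) (Omega : measurableType dO)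
      (Pr : probability Omega R) (pts : Omega -> nat -> Wstar R d3 * R)
      (V : lattice d -> R) (u : R),
    random_interlacements pts P Q nu Pr ->
    (forall x, x \notin K -> V x = 0) ->
    (forall x, 0 <= V x) ->
    0 <= u ->
    laplace_identity pts P Pr K V u).
Proof.
have d0 : (0 < d)%N by exact: leq_trans d3.
pose S := \sum_(x <- K) \sum_(y <- K) greenR R x y.
split; last first.
  move=> P Q nu dO Omega Pr pts V u ri VK V0 u0; have tr := ri_transient ri.
  (* For [V >= 0] the exponential weights are at most 1, so [U = 0] gives a majorant. *)
  apply: (laplace_of_limit ri VK u0 (U := fun=> 0)
    (phi := fun x => limn (fk (fun z => (1 + V z)^-1) ^~ x))) => //.
  - by move=> x; apply: lt_le_trans (V0 x); rewrite ltrN10.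
  - by move=> x; rewrite lexx ltr01.
  - by move=> x; rewrite oppr0.
  - move=> x; exists 1; rewrite subr0 invr1 => n.
    suff -> : fk (fun=> 1 : R) n x = 1 by [].
    elim: n x => [|n ih] x //=; rewrite mul1r -[RHS](avg_cst d0 1 x).
    by congr avg; apply/funext => z; exact: ih.
  - by move=> x; exact: fk_cvg_ge0.
  - by move=> f; exact: greenR_kernel_ge0.
(* Two constraints: [c < 1], which keeps [1 - |V|] positive, and [c * S < 1], the contraction
   condition. The factor 2 keeps [c < 1] when [S = 0]. The absolute value is there because [S] is
   formed before any process is given, when the limits in [greenR] could still be default values. *)
pose c : R := (2 * (1 + `|S|))^-1.
have S1 : 0 < 2 * (1 + `|S|) by rewrite mulr_gt0// ltr_pwDl.
have c0 : 0 < c by rewrite invr_gt0.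
have c1 : c < 1 by rewrite invf_lt1//; have := normr_ge0 S; lra.
have cS : c * S < 1.
  by rewrite /c mulrC ltr_pdivrMr// mul1r; have := ler_norm S; have := normr_ge0 S; lra.
exists c => // P Q nu dO Omega Pr pts V u ri VK Vc u0; have tr := ri_transient ri.
have Vc1 x : `|V x| < 1 by exact: le_lt_trans (Vc x) c1.
have bnd x : exists B, forall n, fk (fun z => (1 - `|V z|)^-1) n x <= B.
  apply: (@fk_bounded_small _ _ d0 tr K (fun z => `|V z|) c x) => //.
    by move=> z zK; rewrite VK// normr0.
  by move=> z; rewrite normr_ge0 Vc.
apply: (laplace_of_limit ri VK u0 (U := fun z => `|V z|)
    (phi := fun x => limn (fk (fun z => (1 + V z)^-1) ^~ x))) => //.
- by move=> z zK; rewrite VK// normr0.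
- by move=> x; have := Vc1 x; rewrite ltr_norml => /andP[].
- by move=> x; rewrite normr_ge0 Vc1.
- by move=> x; rewrite lerNl -normrN ler_norm.
- move=> x; have [B hB] := bnd x; exact: (fk_cvg_small d0 _ Vc1 hB).
- by move=> f; exact: greenR_kernel_small Vc cS.
Qed.
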